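(* Let $\mathcal{D}=\{x=(x_1,x_2,x_3)\in\mathbb{R}^3:\ x_1^2+x_2^2<1\}$ and let $(u,p)$ be a smooth solution of the stationary Navier-Stokes equations $$u\cdot\nabla u+\nabla p-\Delta u=0,\qquad \nabla\cdot u=0\qquad\text{in }\mathcal{D},$$ subject to the total Navier-slip boundary condition $$(\mathbb{S}u\cdot\boldsymbol{n})_\tau=0,\qquad u\cdot\boldsymbol{n}=0\qquad\text{on }\partial\mathcal{D}.$$ I. Suppose that $u\in W^{1,\infty}(\mathcal{D})$, that $u$ is axially symmetric, and that its flux $\Phi$ equals $0$. Then there is a constant $C_1\in\mathbb{R}$ such that $$u=C_1 r\,\boldsymbol{e_\theta},\qquad p=\frac{C_1^2r^2}{2}\quad\text{(up to an additive constant)}.$$ II. Suppose that $u$ is periodic in $z=x_3$ (no axial symmetry of $u$, periodicity of $p$, or vanishing of the flux is assumed). Then there are constants $C_1,C_2\in\mathbb{R}$ such that $$u=C_1 r\,\boldsymbol{e_\theta}+C_2\,\boldsymbol{e_z},\qquad p=\frac{C_1^2r^2}{2}\quad\text{(up to an additive constant)}.$$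
   Context: Here $u:\mathcal{D}\to\mathbb{R}^3$ is the velocity and $p:\mathcal{D}\to\mathbb{R}$ the pressure; smooth means smooth up to the boundary, so that the boundary conditions make sense classically. $\mathbb{S}u=\frac12(\nabla u+(\nabla u)^T)$, $\boldsymbol{n}$ is the unit outer normal on $\partial\mathcal{D}$, and $v_\tau=v-(v\cdot\boldsymbol{n})\boldsymbol{n}$ is the tangential part of a vector field $v$. $u\in W^{1,\infty}(\mathcal{D})$ means that $u$ and $\nabla u$ are bounded on $\mathcal{D}$. Cylindrical coordinates: $x=(r\cos\theta,r\sin\theta,z)$, with $\boldsymbol{e_r}=(x_1/r,x_2/r,0)$, $\boldsymbol{e_\theta}=(-x_2/r,x_1/r,0)$, $\boldsymbol{e_z}=(0,0,1)$; thus $r\boldsymbol{e_\theta}=(-x_2,x_1,0)$. $u$ is axially symmetric if $u=u_r(r,z)\boldsymbol{e_r}+u_\theta(r,z)\boldsymbol{e_\theta}+u_z(r,z)\boldsymbol{e_z}$ with components independent of $\theta$. Flux: $\Phi=\int_{\Sigma}u(x_h,z)\cdot\boldsymbol{e_z}\,dx_h$, where $x_h=(x_1,x_2)$ and $\Sigma=\{|x_h|<1\}$; it does not depend on $z$, because $u$ is divergence free and $u\cdot\boldsymbol{n}=0$ on $\partial\mathcal{D}$. *)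

(* Defs.v *)
From HB Require Import structures.
From mathcomp Require Import all_boot all_order all_algebra.
From mathcomp Require Import all_classical all_reals all_analysis.

Set Implicit Arguments.
Unset Strict Implicit.
Unset Printing Implicit Defensive.

Import Order.TTheory GRing.Theory Num.Theory numFieldNormedType.Exports.

Local Open Scope classical_set_scope.
Local Open Scope ring_scope.

(* Points and vectors of R^3 are row vectors; the coordinates (x_1, x_2, x_3)
   of x are (x 0 0, x 0 1, x 0 2).  The norm of 'rV[R]_3 is the sup norm, which
   only matters up to equivalence here (topology and boundedness). *)

Section Pipe.
Variable R : realType.
Implicit Types (x n v w : 'rV[R]_3) (u : 'rV[R]_3 -> 'rV[R]_3).
Implicit Types (f p : 'rV[R]_3 -> R) (D : set 'rV[R]_3).

Definition vec3 (a b c : R) : 'rV[R]_3 := \row_(j < 3) [:: a; b; c]`_j.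

Definition dot v w : R := \sum_(i < 3) v 0 i * w 0 i.

Definition pipe : set 'rV[R]_3 := [set x | x 0 0 ^+ 2 + x 0 1 ^+ 2 < 1].

Definition pipe_boundary : set 'rV[R]_3 :=
  [set x | x 0 0 ^+ 2 + x 0 1 ^+ 2 = 1].

Definition pipe_normal x : 'rV[R]_3 := vec3 (x 0 0) (x 0 1) 0.

Definition tangential n v : 'rV[R]_3 := v - dot v n *: n.

Definition pd (i : 'I_3) f : 'rV[R]_3 -> R := 'D_(delta_mx 0 i) f.

Definition iter_pd (s : seq 'I_3) f : 'rV[R]_3 -> R := foldr pd f s.

Definition component u (i : 'I_3) : 'rV[R]_3 -> R := fun x => u x 0 i.

(* f is C^oo on the open set D and every iterated partial derivative of f
   (f included) extends continuously to the closure of D.  The values of f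
   outside D are irrelevant. *)
Definition smooth_up_to_boundary D f : Prop :=
  forall s : seq 'I_3,
    (forall (i : 'I_3) x, D x -> derivable (iter_pd s f) x (delta_mx 0 i)) /\
    (exists g : 'rV[R]_3 -> R,
        {within closure D, continuous g} /\
        (forall x, D x -> g x = iter_pd s f x)).

(* Value at x in closure D of the continuous extension of F from D. *)
Definition bdry_value D (T : ptopologicalType) (F : 'rV[R]_3 -> T) x : T :=
  lim (F y @[y --> within D (nbhs x)]).

Definition grad p x : 'rV[R]_3 := \row_j pd j p x.

Definition vgrad u x : 'M[R]_3 := \matrix_(i, j) pd j (component u i) x.

Definition divergence u x : R := \sum_(i < 3) pd i (component u i) x.

Definition vlaplacian u x : 'rV[R]_3 :=
  \row_j \sum_(i < 3) pd i (pd i (component u j)) x.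

Definition convection u x : 'rV[R]_3 :=
  \row_j \sum_(i < 3) u x 0 i * pd i (component u j) x.

Definition strain u x : 'M[R]_3 := 2^-1 *: (vgrad u x + (vgrad u x)^T).

Definition mulMv (A : 'M[R]_3) v : 'rV[R]_3 := (A *m v^T)^T.

Record smooth_slip_NS_solution u p : Prop := {
  velocity_smooth : forall i : 'I_3, smooth_up_to_boundary pipe (component u i);
  pressure_smooth : smooth_up_to_boundary pipe p;
  momentum : forall x, pipe x ->
    convection u x + grad p x - vlaplacian u x = 0;
  incompressible : forall x, pipe x -> divergence u x = 0;
  slip : forall x, pipe_boundary x ->
    tangential (pipe_normal x)
      (mulMv (bdry_value pipe (strain u) x) (pipe_normal x)) = 0;
  impermeable : forall x, pipe_boundary x ->
    dot (bdry_value pipe u x) (pipe_normal x) = 0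
}.

Definition W1infty u : Prop :=
  [bounded u x | x in pipe] /\ [bounded vgrad u x | x in pipe].

Definition cyl_radius x : R := Num.sqrt (x 0 0 ^+ 2 + x 0 1 ^+ 2).

(* On the axis r = 0 these two are 0, by the convention a / 0 = 0. *)
Definition e_r x : 'rV[R]_3 :=
  vec3 (x 0 0 / cyl_radius x) (x 0 1 / cyl_radius x) 0.

Definition e_theta x : 'rV[R]_3 :=
  vec3 (- x 0 1 / cyl_radius x) (x 0 0 / cyl_radius x) 0.

Definition e_z : 'rV[R]_3 := vec3 0 0 1.

(* Required off the axis only, where e_r and e_theta make sense. *)
Definition axially_symmetric u : Prop :=
  exists ur utheta uz : R -> R -> R, forall x, pipe x -> 0 < cyl_radius x ->
    u x = ur (cyl_radius x) (x 0 2) *: e_r x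
          + utheta (cyl_radius x) (x 0 2) *: e_theta x
          + uz (cyl_radius x) (x 0 2) *: e_z.

Definition disk : set (R * R) := [set y | y.1 ^+ 2 + y.2 ^+ 2 < 1].

Definition flux u (z : R) : R :=
  \int[(@lebesgue_measure R \x @lebesgue_measure R)%E]_(y in disk)
    dot (u (vec3 y.1 y.2 z)) e_z.

Definition z_periodic u : Prop :=
  exists L : R, 0 < L /\ forall x, pipe x -> u (x + L *: e_z) = u x.

End Pipe.

(* Main.v *)
Require Import Defs.
From mathcomp Require Import all_boot all_order all_algebra.
From mathcomp Require Import all_classical all_reals all_analysis.
From mathcomp Require Import measurable_realfun ring lra.
Import Order.TTheory GRing.Theory Num.Theory numFieldNormedType.Exports.
Local Open Scope classical_set_scope.
Local Open Scope ring_scope.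
Set Implicit Arguments.
Unset Strict Implicit.
Unset Printing Implicit Defensive.

(** Write x_h = (x_1, x_2), u_h and grad_h for horizontal parts, and integrate over
    the cross-sections of the cylinder ([sint]). Everything rests on an energy flux
    E(z) through the section at height z.

    The standard energy identity dissipates twice the squared strain, where
    d_3 u_h and grad_h u_3 enter through their sum only. Adding to the flux the field
    2 (- u_h d_3 u_3, u_h . grad_h u_3), which is tangential to the wall and whose
    divergence is 2 (d_3 u_3)^2 + 2 d_3 u_h . grad_h u_3, replaces it by the sum Q of
    the squares of the horizontal strain (twice), of d_3 u_h and of grad_h u_3
    ([energy_identity]). The slip conditions let no energy through the wall, because
    the stress there is normal and the velocity tangential ([energy_flux_lateral]).
    Hence E' is minus the integral of Q ([is_derive_energy]). A flow with Q = 0 is a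
    rigid motion that preserves the cylinder, and its pressure balances the
    centrifugal force ([rigid_motion]). It remains to show that Q vanishes.

    When u is periodic the pressure gradient is periodic too, so the pressure
    increases by a constant over a period. The flux of axial momentum is independent
    of z, since the slip conditions also remove friction; this forces the constant to
    be zero ([periodic_pressure]). Then E is both periodic and nonincreasing, so it is
    constant.

    When u is axially symmetric with zero flux, E contains the integral of u_3 p, and
    the pressure is not known to be bounded. Let g(x_h, z) be the integral of
    s u_3(s x_h, z) over 0 < s < 1, so that div_h (g x_h) = u_3. By symmetry and zero
    flux, g vanishes on the wall ([radial_mean_lateral_zero]). Integration by parts
    turns the integral of u_3 p into that of - g x_h . grad_h p, and the momentum
    equation eliminates the pressure: the vorticity term drops out because g has no
    angular derivative, and the term with d_3^2 u_h is a z-derivative up to controlled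
    terms. The outcome is E = e + d', with d bounded ([is_derive_flux_potential]). The
    Poincare inequalities |g| <= |u_3| <= |grad_h u_3| in L^2 of a section
    ([radial_mean_poincare]) and the bounds on u and grad u give
    |e| <= l + (K / l) q for every l > 0, with q the integral of Q
    ([section_reduced_flux_bound]). A bounded d and E' = - q are then compatible only
    with q = 0 ([dissipation_eq0]).

    The divergence theorem on the disk is obtained from Fubini and cut-off functions
    that vanish on the circle ([dint_divergence]). *)

(** * Integrals over the unit disk *)

Section PlanarMeasurability.
Context {R : realType}.

(** The measurable structure of the plane is the product one, so an open set has
    to be written as a countable union of rational boxes. *)
Lemma open_measurable_plane (U : set (R * R)) : open U -> measurable U.
Proof.
move=> oU.
pose box (q : (rat * rat) * (rat * rat)) : set (R * R) :=
  `]ratr q.1.1, ratr q.1.2[%classic `*` `]ratr q.2.1, ratr q.2.2[%classic.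
pose F q := if `[< box q `<=` U >] then box q else set0.
have -> : U = \bigcup_q F q.
  apply/seteqP; split => [[x y] Uxy|x [q _]]; last first.
    by rewrite /F; case: asboolP => // qU; exact: qU.
  have [/= [V W] [/= Vx Wy] VW] := open_nbhs_nbhs (conj oU Uxy).
  move: Vx Wy => /nbhs_ballP[/= e e0 eV] /nbhs_ballP[/= d d0 dW].
  have sq (a r : R) : 0 < r -> exists q : rat * rat,
      ratr q.1 < a < ratr q.2 /\
      forall b, ratr q.1 < b < ratr q.2 -> ball a r b.
    move=> r0; have [q1] := @rat_in_itvoo R (a - r) a ltac:(lra).
    have [q2] := @rat_in_itvoo R a (a + r) ltac:(lra).
    rewrite !in_itv/= => /andP[h3 h4] /andP[h1 h2]; exists (q1, q2) => /=.
    split; first by rewrite h2 h3.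
    move=> b /andP[h5 h6]; rewrite /ball/= ltr_norml; apply/andP; split; lra.
  have [q1 [xq1 q1V]] := sq x e e0; have [q2 [yq2 q2W]] := sq y d d0.
  exists (q1, q2) => //; rewrite /F; case: asboolP => [_|].
    by split => /=; rewrite in_itv.
  case=> -[a b] [/=]; rewrite !in_itv/= => ha hb; apply: VW; split => /=.
    by apply: eV; exact: q1V.
  by apply: dW; exact: q2W.
apply: countable_bigcupT_measurable => // q; rewrite /F; case: asboolP => // _.
by apply: measurableX; exact: measurable_itv.
Qed.

Lemma continuous_measurable_plane (g : R * R -> R) :
  continuous g -> measurable_fun setT g.
Proof.
move=> cg; apply: (measurability _ (RGenOInfty.measurableE R)).
move=> /= _ [_ [a ->]] <-; apply: measurableI => //.
apply: open_measurable_plane; apply: open_comp => //; exact: rray_open.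
Qed.

End PlanarMeasurability.

Section UnitDisk.
Context {R : realType}.
Local Notation leb2 := (@lebesgue_measure R \x @lebesgue_measure R)%E.
Implicit Types h k : R * R -> R.

Lemma continuous_fst2 : continuous (fun y : R * R => y.1).
Proof. by move=> [x y]; exact: cvg_fst. Qed.

Lemma continuous_snd2 : continuous (fun y : R * R => y.2).
Proof. by move=> [x y]; exact: cvg_snd. Qed.

Lemma open_disk : open (@disk R).
Proof.
have -> : @disk R = (fun y : R * R => y.1 ^+ 2 + y.2 ^+ 2) @^-1` [set t | t < 1].
  by [].
apply: open_comp; last exact: lray_open.
move=> y _; apply: cvgD; apply: cvgM;
  by [exact: continuous_fst2|exact: continuous_snd2].
Qed.

Lemma measurable_disk : measurable (@disk R).
Proof. exact: open_measurable_plane open_disk. Qed.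

Lemma disk_sub_square : @disk R `<=` `[-1, 1]%classic `*` `[-1, 1]%classic.
Proof.
move=> [x y]; rewrite /disk/= => xy; split => /=; rewrite in_itv/=.
  by have := sqr_ge0 y; move=> ?; apply/andP; split; nra.
by have := sqr_ge0 x; move=> ?; apply/andP; split; nra.
Qed.

Lemma disk_measure_fin : (leb2 (@disk R) < +oo)%E.
Proof.
apply: (@le_lt_trans _ _ (leb2 (`[-1, 1]%classic `*` `[-1, 1]%classic))).
  apply: le_measure; rewrite ?inE.
  - exact: measurable_disk.
  - by apply: measurableX; exact: measurable_itv.
  - exact: disk_sub_square.
rewrite product_measure1E; [|exact: measurable_itv..].
have side : lebesgue_measure `[(-1 : R), 1]%classic = 2%:E.
  rewrite lebesgue_measure_itv/= lte_fin ifT; last lra.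
  by rewrite -EFinD; congr EFin; lra.
rewrite [X in (X < _)%E](_ : _ = (2 * 2)%:E) ?ltry//.
by rewrite EFinM; congr (_ * _)%E; exact: side.
Qed.

End UnitDisk.

Section DiskIntegral.
Context {R : realType}.
Local Notation leb := (@lebesgue_measure R).
Local Notation leb2 := (@lebesgue_measure R \x @lebesgue_measure R)%E.
Implicit Types h k : R * R -> R.

(** Functions on the disk are only known through an extension continuous on the
    plane: this one property yields measurability, boundedness on the disk and
    integrability. *)
Definition planar h : Prop :=
  exists2 g : R * R -> R, continuous g & forall y, disk y -> g y = h y.

(** The measure is the product of two Lebesgue measures, as in the flux. *)
Definition dint h : R := \int[leb2]_(y in @disk R) h y.

Lemma eq_dint h k : (forall y, disk y -> h y = k y) -> dint h = dint k.
Proof. by move=> hk; apply: eq_Rintegral => y /set_mem /hk. Qed.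

Lemma eq_planar h k : (forall y, disk y -> h y = k y) -> planar h -> planar k.
Proof. by move=> hk [g cg gh]; exists g => // y dy; rewrite gh// hk. Qed.

Lemma continuous_planar h : continuous h -> planar h.
Proof. by move=> ch; exists h. Qed.

Lemma planar_cst c : planar (fun=> c).
Proof. by exists (fun=> c) => // y; exact: cvg_cst. Qed.

Lemma planarD h k : planar h -> planar k -> planar (fun y => h y + k y).
Proof.
move=> [g cg gh] [l cl lk]; exists (fun y => g y + l y).
  by move=> y; apply: cvgD; [exact: cg|exact: cl].
by move=> y dy; rewrite gh// lk.
Qed.

Lemma planarM h k : planar h -> planar k -> planar (fun y => h y * k y).
Proof.
move=> [g cg gh] [l cl lk]; exists (fun y => g y * l y).
  by move=> y; apply: cvgM; [exact: cg|exact: cl].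
by move=> y dy; rewrite gh// lk.
Qed.

Lemma planarN h : planar h -> planar (fun y => - h y).
Proof.
move=> ph; apply: eq_planar (planarM (planar_cst (-1)) ph) => y _ /=.
by rewrite mulN1r.
Qed.

Lemma planar_norm h : planar h -> planar (fun y => `|h y|).
Proof.
move=> [g cg gh]; exists (fun y => `|g y|).
  by move=> y; apply: cvg_norm; exact: cg.
by move=> y dy; rewrite gh.
Qed.

Lemma planar_bounded h : planar h ->
  exists2 M : R, 0 < M & forall y, disk y -> `|h y| <= M.
Proof.
move=> [g cg gh].
have : compact (g @` (`[-1, 1]%classic `*` `[-1, 1]%classic)).
  apply: continuous_compact; first exact: continuous_subspaceT.
  by apply: compact_setX; exact: segment_compact.
move=> /compact_bounded[M [_ gM]].
exists (`|M| + 1); first by rewrite ltr_pwDr.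
move=> y dy; rewrite -gh//; apply: gM; first by rewrite (le_lt_trans (ler_norm _))// ltrDl.
by exists y => //; exact: disk_sub_square.
Qed.

Lemma planar_measurable h : planar h -> measurable_fun (@disk R) h.
Proof.
move=> [g cg gh]; apply: (eq_measurable_fun g) => [y /set_mem /gh//|].
by apply: measurable_funTS; exact: continuous_measurable_plane.
Qed.

Lemma planar_integrable h : planar h -> leb2.-integrable (@disk R) (EFin \o h).
Proof.
move=> ph; apply: measurable_bounded_integrable.
- exact: measurable_disk.
- exact: disk_measure_fin.
- exact: planar_measurable.
have [M M0 hM] := planar_bounded ph; exists M; split; first exact: num_real.
by move=> N MN y dy /=; rewrite (le_trans (hM _ dy))// ltW.
Qed.

Lemma dintD h k : planar h -> planar k ->
  dint (fun y => h y + k y) = dint h + dint k.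
Proof.
move=> ph pk; apply: RintegralD; [exact: measurable_disk|..];
  exact: planar_integrable.
Qed.

Lemma dintZ c h : planar h -> dint (fun y => c * h y) = c * dint h.
Proof.
by move=> ph; apply: RintegralZl; [exact: measurable_disk|exact: planar_integrable].
Qed.

Lemma dintN h : planar h -> dint (fun y => - h y) = - dint h.
Proof.
move=> ph; rewrite -mulN1r -dintZ//; apply: eq_dint => y _.
by rewrite mulN1r.
Qed.

Lemma dintB h k : planar h -> planar k ->
  dint (fun y => h y - k y) = dint h - dint k.
Proof.
by move=> ph pk; rewrite dintD ?dintN//; exact: planarN.
Qed.

Lemma dint_ge0 h : (forall y, disk y -> 0 <= h y) -> 0 <= dint h.
Proof. by move=> h0; apply: Rintegral_ge0. Qed.

Lemma le_dint h k : planar h -> planar k ->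
  (forall y, disk y -> h y <= k y) -> dint h <= dint k.
Proof.
by move=> ph pk hk; apply: le_Rintegral => //; [exact: measurable_disk|exact: planar_integrable..].
Qed.

Lemma ler_norm_dint h : planar h -> `|dint h| <= dint (fun y => `|h y|).
Proof.
by move=> ph; apply: le_normr_Rintegral => //; [exact: measurable_disk|exact: planar_integrable].
Qed.

Lemma chord_integral (G G' : R -> R) (c : R) : 0 < c ->
  continuous G -> continuous G' ->
  (forall t : R, - c < t < c -> is_derive t 1 G (G' t)) ->
  G c = 0 -> G (- c) = 0 ->
  (\int[leb]_(t in `](- c)%R, c[) (G' t)%:E = 0)%E.
Proof.
move=> c0 cG cG' dG Gc GNc.
rewrite (@integral_itv_bndo_bndc _ _ _ (fun t => (G' t)%:E)); last first.
  by apply/measurable_EFinP; apply: measurable_funTS; exact: continuous_measurable_fun.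
rewrite (@integral_itv_obnd_cbnd _ _ _ (fun t => (G' t)%:E)); last first.
  by apply/measurable_EFinP; apply: measurable_funTS; exact: continuous_measurable_fun.
rewrite (@continuous_FTC2 _ G' G (- c) c); last 4 first.
- by lra.
- exact: continuous_subspaceT.
- split.
  + by move=> t; rewrite in_itv/= => /dG[].
  + exact/cvg_at_right_filter/cG.
  + exact/cvg_at_left_filter/cG.
- by move=> t; rewrite in_itv/= => /dG[_ <-]; rewrite derive1E.
by rewrite Gc GNc subee.
Qed.

End DiskIntegral.

(** * The divergence theorem on the disk *)

Section ChordIntegrals.
Context {R : realType}.
Local Notation leb := (@lebesgue_measure R).
Local Notation leb2 := (@lebesgue_measure R \x @lebesgue_measure R)%E.

(** A line parallel to an axis meets the disk in an interval whose end points
    lie on the circle; Fubini reduces integrals over the disk to such chords. *)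
Lemma disk_chord (b t : R) : b ^+ 2 < 1 ->
  (t ^+ 2 + b ^+ 2 < 1) = (t \in `]- Num.sqrt (1 - b ^+ 2), Num.sqrt (1 - b ^+ 2)[).
Proof.
move=> b1; rewrite in_itv/= -ltr_norml -sqrtr_sqr ltr_sqrt; last lra.
by rewrite -ltrBrDr.
Qed.

Lemma planar_chord_integral (G G' : R -> R) (b : R) :
  continuous G -> continuous G' ->
  (forall t : R, t ^+ 2 + b ^+ 2 < 1 -> is_derive t 1 G (G' t)) ->
  (forall t : R, t ^+ 2 + b ^+ 2 = 1 -> G t = 0) ->
  (\int[leb]_(t in [set t : R | (t ^+ 2 + b ^+ 2 < 1)%R]) (G' t)%:E = 0)%E.
Proof.
move=> cG cG' dG G0; have [b1|b1] := ltP (b ^+ 2) 1; last first.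
  rewrite (_ : [set _ | _] = set0) ?integral_set0//.
  by apply/seteqP; split => // t /=; have := sqr_ge0 t; lra.
have h : 0 < 1 - b ^+ 2 by lra.
have sq : Num.sqrt (1 - b ^+ 2) ^+ 2 = 1 - b ^+ 2 by rewrite sqr_sqrtr// ltW.
rewrite (_ : [set _ | _] = `]- Num.sqrt (1 - b ^+ 2), Num.sqrt (1 - b ^+ 2)[%classic).
  apply: (@chord_integral _ G) => //.
  - by rewrite sqrtr_gt0.
  - by move=> t ht; apply: dG; rewrite disk_chord// in_itv.
  - by apply: G0; rewrite sq subrK.
  - by apply: G0; rewrite sqrrN sq subrK.
by apply/seteqP; split => t /=; rewrite disk_chord.
Qed.

Lemma continuous_slice1 (g : R * R -> R) (b : R) :
  continuous g -> continuous (fun t : R => g (t, b)).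
Proof.
move=> cg t; apply: (@continuous_comp _ _ _ (fun t : R => (t, b)) g); last exact: cg.
by apply: (@cvg_pair _ _ _ (nbhs t) (nbhs t) (nbhs b)); [exact: cvg_id|exact: cvg_cst].
Qed.

Lemma continuous_slice2 (g : R * R -> R) (b : R) :
  continuous g -> continuous (fun t : R => g (b, t)).
Proof.
move=> cg t; apply: (@continuous_comp _ _ _ (fun t : R => (b, t)) g); last exact: cg.
by apply: (@cvg_pair _ _ _ (nbhs t) (nbhs b) (nbhs t)); [exact: cvg_cst|exact: cvg_id].
Qed.

Let integrable_patch (g : R * R -> R) : continuous g ->
  leb2.-integrable setT ((EFin \o g) \_ (@disk R)).
Proof.
move=> cg; have := planar_integrable (continuous_planar cg).
exact: (iffLR (integrable_mkcond (mu := leb2) (EFin \o g) measurable_disk)).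
Qed.

(** Fubini along horizontal chords, at whose ends [g] vanishes. *)
Lemma dint_d1 (g g' : R * R -> R) : continuous g -> continuous g' ->
  (forall y, disk y -> is_derive y.1 1 (fun t => g (t, y.2)) (g' y)) ->
  (forall y, y.1 ^+ 2 + y.2 ^+ 2 = 1 -> g y = 0) ->
  dint g' = 0.
Proof.
move=> cg cg' dg g0.
rewrite /dint /Rintegral integral_mkcond -integral21_prod_meas1; last first.
  exact: integrable_patch.
rewrite (_ : fubini_G _ _ = cst 0%E) ?integral0//.
apply/funext => b; rewrite /fubini_G /=.
rewrite -[RHS](@planar_chord_integral (fun t => g (t, b)) (fun t => g' (t, b)) b).
- rewrite [RHS]integral_mkcond; apply: eq_integral => t _.
  by rewrite !patchE; congr (if _ then _ else _); apply/idP/idP; rewrite !inE.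
- exact: continuous_slice1.
- exact: continuous_slice1.
- by move=> t tb; exact: (dg (t, b)).
- by move=> t tb; exact: g0.
Qed.

Lemma dint_d2 (g g' : R * R -> R) : continuous g -> continuous g' ->
  (forall y, disk y -> is_derive y.2 1 (fun t => g (y.1, t)) (g' y)) ->
  (forall y, y.1 ^+ 2 + y.2 ^+ 2 = 1 -> g y = 0) ->
  dint g' = 0.
Proof.
move=> cg cg' dg g0.
rewrite /dint /Rintegral integral_mkcond -integral12_prod_meas1; last first.
  exact: integrable_patch.
rewrite (_ : fubini_F _ _ = cst 0%E) ?integral0//.
apply/funext => b; rewrite /fubini_F /=.
rewrite -[RHS](@planar_chord_integral (fun t => g (b, t)) (fun t => g' (b, t)) b).
- rewrite [RHS]integral_mkcond; apply: eq_integral => t _.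
  by rewrite !patchE; congr (if _ then _ else _); apply/idP/idP; rewrite !inE /disk/= addrC.
- exact: continuous_slice2.
- exact: continuous_slice2.
- by move=> t tb; apply: (dg (b, t)); rewrite /disk/= addrC.
- by move=> t tb; apply: g0; rewrite /= addrC.
Qed.

End ChordIntegrals.

Section PointwiseDerivatives.
Context {R : realType} {V : normedModType R}.
Implicit Types (f g : V -> R) (x v : V).

Lemma is_derive_add f g x v (a b : R) : is_derive x v f a -> is_derive x v g b ->
  is_derive x v (fun y => f y + g y) (a + b).
Proof. by move=> df dg; apply: is_deriveD. Qed.

Lemma is_derive_opp f x v (a : R) : is_derive x v f a ->
  is_derive x v (fun y => - f y) (- a).
Proof. by move=> df; apply: is_deriveN. Qed.

Lemma is_derive_mul f g x v (a b : R) : is_derive x v f a -> is_derive x v g b ->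
  is_derive x v (fun y => f y * g y) (a * g x + f x * b).
Proof.
move=> df dg; have := is_deriveM df dg.
by rewrite addrC /GRing.scale/= [g x * a]mulrC.
Qed.

Lemma is_derive_const (c : R) x v : is_derive x v (fun=> c) 0.
Proof. exact: is_derive_cst. Qed.

Lemma is_derive_exp f n x v (a : R) : is_derive x v f a ->
  is_derive x v (fun y => f y ^+ n.+1) (n.+1%:R * f x ^+ n * a).
Proof.
by move=> df; have := is_deriveX n.+1 df; rewrite exprfctE /GRing.scale/=.
Qed.

End PointwiseDerivatives.

Section DiskDivergence.
Context {R : realType}.
Implicit Types y : R * R.

Let t y := y.1 ^+ 2 + y.2 ^+ 2.

Let ct : continuous t.
Proof.
by move=> y; apply: cvgD; apply: cvgM;
  by [exact: continuous_fst2|exact: continuous_snd2].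
Qed.

Let ctX n : continuous (fun y => t y ^+ n).
Proof.
move=> y; elim: n => [|n IH]; first exact: cvg_cst.
rewrite (_ : (fun y => _) = (fun y => t y * t y ^+ n)); last by apply/funext => z; rewrite exprS.
by apply: cvgM => //; exact: ct.
Qed.

Let t_ge0 y : 0 <= t y.
Proof. by rewrite addr_ge0// sqr_ge0. Qed.

Let dt1 y n : is_derive y.1 1 (fun a : R => 1 - t (a, y.2) ^+ n.+1)
  (- (n.+1%:R * t y ^+ n * (2 * y.1))).
Proof.
have /= d := is_derive_add (is_derive_const (1 : R) y.1 1)
  (is_derive_opp (is_derive_exp n (is_derive_add
    (is_derive_exp 1 (is_derive_id y.1 1)) (is_derive_const (y.2 ^+ 2) y.1 1)))).
by apply: (is_derive_eq d); rewrite /t; ring.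
Qed.

Let dt2 y n : is_derive y.2 1 (fun a : R => 1 - t (y.1, a) ^+ n.+1)
  (- (n.+1%:R * t y ^+ n * (2 * y.2))).
Proof.
have /= d := is_derive_add (is_derive_const (1 : R) y.2 1)
  (is_derive_opp (is_derive_exp n (is_derive_add
    (is_derive_const (y.1 ^+ 2) y.2 1) (is_derive_exp 1 (is_derive_id y.2 1))))).
by apply: (is_derive_eq d); rewrite /t; ring.
Qed.

Let eta n y := 1 - t y ^+ n.+1.

Let ceta n : continuous (eta n).
Proof.
by move=> y; apply: cvgB; [exact: cvg_cst|exact: ctX].
Qed.

(** Multiplying the field by 1 - |y|^(2n+2) makes it vanish on the circle, so its
    divergence integrates to zero; only the derivative of the cut-off remains.
    Here [t y] is |y|^2. *)
Lemma dint_cutoff (g1 g2 k1 k2 : R * R -> R) n :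
  continuous g1 -> continuous g2 -> continuous k1 -> continuous k2 ->
  (forall y, disk y -> is_derive y.1 1 (fun a => g1 (a, y.2)) (k1 y)) ->
  (forall y, disk y -> is_derive y.2 1 (fun a => g2 (y.1, a)) (k2 y)) ->
  dint (fun y => (1 - t y ^+ n.+1) * (k1 y + k2 y)) =
  2 * n.+1%:R * dint (fun y => t y ^+ n * (y.1 * g1 y + y.2 * g2 y)).
Proof.
move=> c1 c2 ck1 ck2 d1 d2.
have e0 y : y.1 ^+ 2 + y.2 ^+ 2 = 1 -> eta n y = 0.
  by move=> ty; rewrite /eta /t ty expr1n subrr.
pose h1 y := - (n.+1%:R * t y ^+ n * (2 * y.1)).
pose h2 y := - (n.+1%:R * t y ^+ n * (2 * y.2)).
have ch1 : continuous h1.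
  move=> y; apply: cvgN; apply: cvgM; apply: cvgM;
    by [exact: cvg_cst|exact: ctX|exact: continuous_fst2].
have ch2 : continuous h2.
  move=> y; apply: cvgN; apply: cvgM; apply: cvgM;
    by [exact: cvg_cst|exact: ctX|exact: continuous_snd2].
have cp1 : continuous (fun y => h1 y * g1 y + eta n y * k1 y).
  by move=> y; apply: cvgD; apply: cvgM; by [exact: ch1|exact: c1|exact: ceta|exact: ck1].
have cp2 : continuous (fun y => h2 y * g2 y + eta n y * k2 y).
  by move=> y; apply: cvgD; apply: cvgM; by [exact: ch2|exact: c2|exact: ceta|exact: ck2].
have i1 : dint (fun y => h1 y * g1 y + eta n y * k1 y) = 0.
  apply: (@dint_d1 _ (fun y => eta n y * g1 y)) => //.
  - by move=> y; apply: cvgM; [exact: ceta|exact: c1].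
  - move=> y dy; have := is_derive_mul (dt1 y n) (d1 y dy).
    by case: y {dy}.
  - by move=> y /e0 ->; rewrite mul0r.
have i2 : dint (fun y => h2 y * g2 y + eta n y * k2 y) = 0.
  apply: (@dint_d2 _ (fun y => eta n y * g2 y)) => //.
  - by move=> y; apply: cvgM; [exact: ceta|exact: c2].
  - move=> y dy; have := is_derive_mul (dt2 y n) (d2 y dy).
    by case: y {dy}.
  - by move=> y /e0 ->; rewrite mul0r.
have cb : continuous (fun y => t y ^+ n * (y.1 * g1 y + y.2 * g2 y)).
  move=> y; apply: cvgM; first exact: ctX.
  by apply: cvgD; apply: cvgM;
    by [exact: continuous_fst2|exact: continuous_snd2|exact: c1|exact: c2].
have ce : continuous (fun y => eta n y * (k1 y + k2 y)).
  move=> y; apply: cvgM; first exact: ceta.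
  by apply: cvgD; [exact: ck1|exact: ck2].
rewrite -dintZ; last exact: continuous_planar.
apply/eqP; rewrite -subr_eq0 -dintB; last 2 first.
- exact: continuous_planar.
- by apply: planarM; [exact: planar_cst|exact: continuous_planar].
rewrite -[0]addr0 -[in X in _ == X + _]i1 -i2 -dintD; try exact: continuous_planar.
by apply/eqP/eq_dint => y _; rewrite /h1 /h2 /eta; ring.
Qed.

(** The cut-off identity for the field y itself determines the radial moments
    of the disk. *)
Lemma dint_moment n :
  n.+1%:R * dint (fun y => t y ^+ n) = dint (fun=> 1).
Proof.
case: n => [|n]; first by rewrite mul1r; apply: eq_dint => y _.
have c1 : continuous (fun y : R * R => y.1) by exact: continuous_fst2.
have c2 : continuous (fun y : R * R => y.2) by exact: continuous_snd2.
have c3 : continuous (fun _ : R * R => 1 : R) by move=> y; exact: cvg_cst.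
have := @dint_cutoff (fun y => y.1) (fun y => y.2) (fun=> 1) (fun=> 1) n c1 c2 c3 c3
  (fun y _ => is_derive_id _ _) (fun y _ => is_derive_id _ _).
have pt m : planar (fun y => t y ^+ m) by exact: continuous_planar.
rewrite [RHS](_ : _ = 2 * n.+1%:R * dint (fun y => t y ^+ n.+1)); last first.
  by congr (_ * _); apply: eq_dint => y _; rewrite exprS mulrC /t; ring.
rewrite (_ : dint _ = 2 * (dint (fun=> 1) - dint (fun y => t y ^+ n.+1))); last first.
  rewrite -dintB//; last exact: planar_cst.
  rewrite -dintZ; last by apply: planarD; [exact: planar_cst|exact: planarN].
  by apply: eq_dint => y _; ring.
by move=> e; rewrite -[n.+2]addn1 natrD mulrDl mul1r; lra.
Qed.

(** Compactness of the part of the closed disk where [b] is at least [e]: there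
    the distance to the circle is bounded below. *)
Lemma small_near_circle (b : R * R -> R) (e : R) : continuous b ->
  (forall y, t y = 1 -> b y = 0) -> 0 < e ->
  exists2 C, 0 < C & forall y, disk y -> `|b y| <= e + C * (1 - t y).
Proof.
move=> cb b0 e0.
pose K := [set y | t y <= 1] `&` [set y | e <= `|b y|].
have cK : compact K.
  have sq : compact (`[-1, 1]%classic `*` `[-1, 1]%classic : set (R * R)).
    by apply: compact_setX; exact: segment_compact.
  apply: (subclosed_compact _ sq).
  - apply: closedI.
      exact: ((continuous_closedP t).1 ct [set a | a <= 1] (@closed_le R 1)).
    apply: ((continuous_closedP (fun y => `|b y|)).1 _ [set a | e <= a] (@closed_ge R e)).
    by move=> y; apply: cvg_norm; exact: cb.
  - move=> [x y] [/= txy _]; move: txy; rewrite /t/= => xy; split => /=; rewrite in_itv/=.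
      by have := sqr_ge0 y; move=> ?; apply/andP; split; nra.
    by have := sqr_ge0 x; move=> ?; apply/andP; split; nra.
have Kt y : K y -> 0 < 1 - t y.
  case=> /= t1 eb; rewrite subr_gt0 lt_neqAle t1 andbT.
  by apply/eqP => /b0 b0'; move: eb; rewrite b0' normr0; lra.
have : compact ((fun y => (1 - t y)^-1) @` K).
  apply: continuous_compact => //; apply: continuous_in_subspaceT => y /set_mem Ky.
  apply: cvgV; first by rewrite gt_eqF// Kt.
  by apply: cvgB; [exact: cvg_cst|exact: ct].
move=> /compact_bounded[N [_ KN]].
have [M M0 bM] := planar_bounded (continuous_planar cb).
exists (M * (`|N| + 1)); first by rewrite mulr_gt0// ltr_pwDr.
move=> y dy; have t1 : t y < 1 by exact: dy.
have [be|be] := ltP `|b y| e.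
  apply: ltW; apply: (lt_le_trans be); rewrite lerDl.
  apply: mulr_ge0; last lra.
  by apply: mulr_ge0; [exact: ltW|rewrite addr_ge0].
have Ky : K y by split => //=; exact: ltW.
have := KN (`|N| + 1) ltac:(rewrite (le_lt_trans (ler_norm _))// ltrDl//) _ (imageP _ Ky).
have i0 : 0 <= (1 - t y)^-1 by rewrite invr_ge0 ltW// Kt.
rewrite /= (ger0_norm i0) => hN.
have h1 : 1 <= (`|N| + 1) * (1 - t y).
  by rewrite -ler_pdivrMr ?Kt// mul1r.
have := bM y dy; set T := (`|N| + 1) * _ in h1 *.
rewrite -mulrA -/T; nra.
Qed.

(** With the cut-off 1 - |y|^(2n+2) the error is the integral of |y|^(2n+2) k, of
    size 1/(n+2) by the moments, plus 2(n+1) times that of |y|^(2n) b, where b is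
    the outer normal component on the circle. As b is at most e + C (1 - |y|^2),
    the last term is bounded by a multiple of e plus O(1/n). *)
Theorem dint_divergence (g1 g2 k1 k2 : R * R -> R) :
  continuous g1 -> continuous g2 -> continuous k1 -> continuous k2 ->
  (forall y, disk y -> is_derive y.1 1 (fun a => g1 (a, y.2)) (k1 y)) ->
  (forall y, disk y -> is_derive y.2 1 (fun a => g2 (y.1, a)) (k2 y)) ->
  (forall y, y.1 ^+ 2 + y.2 ^+ 2 = 1 -> y.1 * g1 y + y.2 * g2 y = 0) ->
  dint (fun y => k1 y + k2 y) = 0.
Proof.
move=> c1 c2 ck1 ck2 d1 d2 b0.
pose b y := y.1 * g1 y + y.2 * g2 y; pose k y := k1 y + k2 y.
have cb : continuous b.
  by move=> y; apply: cvgD; apply: cvgM;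
    by [exact: continuous_fst2|exact: continuous_snd2|exact: c1|exact: c2].
have ck : continuous k by move=> y; apply: cvgD; [exact: ck1|exact: ck2].
pose A := dint (fun=> 1 : R).
have A0 : 0 <= A by apply: dint_ge0.
have pt m : planar (fun y => t y ^+ m) by exact: continuous_planar.
have pk := continuous_planar ck; have pb := continuous_planar cb.
have [M M0 kM] := planar_bounded pk.
have mom n : dint (fun y => t y ^+ n) = A / n.+1%:R.
  by rewrite /A -(dint_moment n) mulrC mulKf// pnatr_eq0.
suff small (e : R) : 0 < e -> `|dint k| <= 2 * e * A + e.
  apply/eqP; rewrite -normr_le0.
  apply/ler_addgt0Pl => e e0; rewrite addr0.
  have A1 : 0 < 2 * A + 1 by lra.
  have := small (e / (2 * A + 1)) (divr_gt0 e0 A1).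
  by rewrite (_ : 2 * _ * A + _ = e)//; field; lra.
move=> e0.
have [C C0 bC] := small_near_circle cb b0 e0.
have est n : `|dint k| <= 2 * e * A + (M + 2 * C) * A / n.+2%:R.
  have cut := dint_cutoff n c1 c2 ck1 ck2 d1 d2.
  have -> : dint k = dint (fun y => t y ^+ n.+1 * k y) +
      2 * n.+1%:R * dint (fun y => t y ^+ n * b y).
    rewrite -cut -dintD; last 2 first.
    - exact: planarM.
    - by apply: planarM => //; apply: planarD; [exact: planar_cst|exact: planarN].
    by apply: eq_dint => y _; rewrite /k; ring.
  have i1 : `|dint (fun y => t y ^+ n.+1 * k y)| <= M * (A / n.+2%:R).
    rewrite -mom -dintZ//; apply: (le_trans (ler_norm_dint _)); first exact: planarM.
    apply: le_dint; [by apply: planar_norm; exact: planarM|by apply: planarM => //; exact: planar_cst|].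
    move=> y dy; rewrite normrM ger0_norm ?exprn_ge0// mulrC.
    by rewrite ler_wpM2r ?exprn_ge0// kM.
  have i2 : `|dint (fun y => t y ^+ n * b y)| <=
      e * (A / n.+1%:R) + C * (A / n.+1%:R - A / n.+2%:R).
    rewrite -!mom -dintB// -!dintZ//; last by apply: planarD => //; exact: planarN.
    rewrite -dintD; last 2 first.
    - by apply: planarM => //; exact: planar_cst.
    - by apply: planarM; [exact: planar_cst|apply: planarD => //; exact: planarN].
    apply: (le_trans (ler_norm_dint _)); first exact: planarM.
    apply: le_dint.
    - by apply: planar_norm; exact: planarM.
    - apply: planarD; first by apply: planarM => //; exact: planar_cst.
      by apply: planarM; [exact: planar_cst|apply: planarD => //; exact: planarN].
    move=> y dy; rewrite normrM ger0_norm ?exprn_ge0//.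
    rewrite (_ : e * _ + _ = t y ^+ n * (e + C * (1 - t y))); last by rewrite exprS; ring.
    by rewrite ler_wpM2l ?exprn_ge0// bC.
  apply: (le_trans (ler_normD _ _)).
  rewrite normrM ger0_norm; last by rewrite mulr_ge0.
  apply: (le_trans (lerD i1 (ler_wpM2l _ i2))); first by rewrite mulr_ge0.
  rewrite le_eqVlt; apply/orP; left; apply/eqP.
  have n1 : (n.+1%:R : R) != 0 by rewrite pnatr_eq0.
  have n2 : (n.+2%:R : R) != 0 by rewrite pnatr_eq0.
  have n3 : (n.+2%:R : R) = n.+1%:R + 1 by rewrite -natr1.
  rewrite n3 in n2 *; move: (n.+1%:R : R) n1 n2 => N n1 n2.
  by field; rewrite n1 n2.
have [n hn] : exists n : nat, (M + 2 * C) * A / e < n%:R.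
  by exists (Num.bound ((M + 2 * C) * A / e)); apply: archi_boundP; rewrite divr_ge0 ?mulr_ge0// ?ltW//; lra.
apply: (le_trans (est n)); rewrite lerD2l ler_pdivrMr// [e * _]mulrC -ler_pdivrMr//.
by apply: ltW; apply: (lt_trans hn); rewrite ltr_nat ltnS leqnSn.
Qed.

End DiskDivergence.

(** * Vanishing and differentiation of disk integrals *)

Section DiskIntegralPositivity.
Context {R : realType}.
Local Notation leb := (@lebesgue_measure R).
Local Notation leb2 := (@lebesgue_measure R \x @lebesgue_measure R)%E.
Implicit Types y : R * R.

(** A continuous function positive at a point has a positive integral over a
    small box around it. *)
Lemma dint_eq0 (h : R * R -> R) : planar h -> (forall y, disk y -> 0 <= h y) ->
  dint h = 0 -> forall y, disk y -> h y = 0.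
Proof.
move=> ph h0 ih [a b] dy; apply/eqP; rewrite eq_le h0// andbT leNgt.
apply/negP => hy.
have [g cg gh] := ph.
pose c := h (a, b) / 2.
have c0 : 0 < c by rewrite /c; lra.
have : nbhs (a, b) ([set y | c < g y] `&` (@disk R)).
  apply: filterI; last by apply: open_nbhs_nbhs; split => //; exact: open_disk.
  apply: open_nbhs_nbhs; split; last by rewrite /= gh// /c; lra.
  by apply: (@open_comp _ _ g [set r | c < r]) => //; exact: rray_open.
move=> [/= [V W] [/= /nbhs_ballP[/= e e0 eV] /nbhs_ballP[/= d d0 dW]] VW].
pose I r s : set R := `]r - s, r + s[%classic.
have mI r s : measurable (I r s) by exact: measurable_itv.
pose B : set (R * R) := I a e `*` I b d.
have mB : measurable B by exact: measurableX.
have BVW y : B y -> c < h y /\ disk y.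
  case: y => r s [/=]; rewrite /I /= !in_itv/= => hr hs.
  have [/= h1 h2] : ([set y | c < g y] `&` (@disk R)) (r, s).
    apply: VW; split => /=.
      by apply: eV; rewrite /ball/= ltr_norml; apply/andP; split; lra.
    by apply: dW; rewrite /ball/= ltr_norml; apply/andP; split; lra.
  by rewrite -gh.
have mh : measurable_fun (@disk R) (EFin \o h).
  by apply/measurable_EFinP; exact: planar_measurable.
have BD : B `<=` @disk R by move=> y /BVW[].
have mhB : measurable_fun B (EFin \o h).
  exact: (measurable_funS measurable_disk BD mh).
have le1 : (\int[leb2]_(y in B) c%:E <= \int[leb2]_(y in @disk R) (h y)%:E)%E.
  apply: (@le_trans _ _ (\int[leb2]_(y in B) (h y)%:E)%E).
    apply: ge0_le_integral => //.
    - by move=> y _; rewrite lee_fin ltW.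
    - by move=> y /BVW[/ltW ? _]; rewrite lee_fin.
  by apply: ge0_subset_integral => //; exact: measurable_disk.
have mIs r s : 0 < s -> leb (I r s) = (2 * s)%:E.
  move=> s0; rewrite /I lebesgue_measure_itv/= lte_fin ifT; last lra.
  by rewrite -EFinD; congr EFin; lra.
have mBs : leb2 B = (2 * e * (2 * d))%:E.
  rewrite product_measure1E; [|exact: mI..].
  by rewrite EFinM; congr (_ * _)%E; exact: mIs.
have int0 : (\int[leb2]_(y in @disk R) (h y)%:E)%E = 0%E.
  have fin : (\int[leb2]_(y in @disk R) (h y)%:E)%E \is a fin_num.
    by apply: integrable_fin_num; [exact: measurable_disk|exact: planar_integrable].
  by rewrite -(fineK fin); congr EFin; exact: ih.
move: le1; rewrite int0 integral_cst//.
rewrite (_ : (c%:E * _ = (c * (2 * e * (2 * d)))%:E)%E); last first.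
  exact: (congr1 (fun s => (c%:E * s)%E) mBs).
rewrite lee_fin leNgt !mulr_gt0//.
Qed.

Lemma disk_area_gt0 : 0 < dint (fun=> 1 : R).
Proof.
rewrite lt_neqAle dint_ge0// andbT; apply/eqP => /esym A0.
have d0 : disk (0 : R, 0 : R) by rewrite /disk/= expr0n/= addr0.
have := dint_eq0 (planar_cst 1) (fun _ _ => ler01) A0 d0.
by apply/eqP; rewrite oner_eq0.
Qed.

(** Differentiation under the integral sign; only a bound for the parameter near
    [z] is asked, since the fields may be unbounded along the axis. *)
Lemma is_derive_dint (F F' : R -> R * R -> R) (z M : R) :
  (forall z, planar (F z)) ->
  (forall (w : R) y, disk y -> is_derive w 1 (F^~ y) (F' w y)) ->
  (forall w y, z - 1 < w < z + 1 -> disk y -> `|F' w y| <= M) ->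
  is_derive z 1 (fun w => dint (F w)) (dint (F' z)).
Proof.
move=> pF dF F'M.
have Iz : `]z - 1, z + 1[%classic z by rewrite /= in_itv/=; apply/andP; split; lra.
have p1 w y : disk y -> partial1of2 F w y = F' w y.
  by move=> dy; rewrite partial1of2E; have [_ ->] := dF w y dy.
have M0 : forall y : R * R, 0 <= `|M| by [].
have G_ub w y : `]z - 1, z + 1[%classic w -> disk y -> `|partial1of2 F w y| <= `|M|.
  move=> /=; rewrite in_itv/= => Iw dy; rewrite p1//.
  by rewrite (le_trans (F'M _ _ Iw dy))// ler_norm.
have dF1 (w : R) y : `]z - 1, z + 1[%classic w -> disk y -> derivable (F^~ y) w 1.
  by move=> _ dy; have [] := dF w y dy.
have pG := planar_integrable (planar_cst `|M|).
have iF w : `]z - 1, z + 1[%classic w -> leb2.-integrable (@disk R) (EFin \o F w).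
  by move=> _; exact: planar_integrable.
have mD := @measurable_disk R.
split.
  rewrite /dint; refine (@derivable_under_integral R _ _ leb2 F (@disk R) mD z _ _ Iz iF dF1 (fun=> `|M|) M0 pG G_ub).
rewrite -derive1E.
rewrite /dint (@differentiation_under_integral R _ _ leb2 F (@disk R) mD z _ _ Iz iF dF1 (fun=> `|M|) M0 pG G_ub).
by apply: (eq_dint (k := F' z)) => y dy; exact: p1.
Qed.

End DiskIntegralPositivity.

(** * The closed cylinder *)

Section PointwiseContinuity.
Context {R : realType} {T : topologicalType}.
Implicit Types f g : T -> R.

Lemma continuous_add f g : continuous f -> continuous g ->
  continuous (fun x => f x + g x).
Proof. by move=> cf cg x; exact: (cvgD (cf x) (cg x)). Qed.

Lemma continuous_sub f g : continuous f -> continuous g ->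
  continuous (fun x => f x - g x).
Proof. by move=> cf cg x; exact: (cvgB (cf x) (cg x)). Qed.

Lemma continuous_mul f g : continuous f -> continuous g ->
  continuous (fun x => f x * g x).
Proof. by move=> cf cg x; exact: (cvgM (cf x) (cg x)). Qed.

Lemma continuous_const (c : R) : continuous (fun _ : T => c).
Proof. by move=> x; exact: cvg_cst. Qed.

Lemma continuous_inv f : continuous f -> (forall x, f x != 0) ->
  continuous (fun x => (f x)^-1).
Proof. by move=> cf f0 x; exact: (cvgV (f0 x) (cf x)). Qed.

End PointwiseContinuity.

Section Space.
Context {R : realType}.
Implicit Types (x y v : 'rV[R]_3) (f g : 'rV[R]_3 -> R).

Lemma sum3E (W : nmodType) (F : 'I_3 -> W) : \sum_(i < 3) F i = F 0 + F 1 + F 2.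
Proof.
rewrite !big_ord_recr big_ord0/= add0r.
by congr (_ + _ + _); congr F; exact: val_inj.
Qed.

Lemma vec3E0 (a b c : R) : vec3 a b c 0 0 = a.
Proof. by rewrite mxE. Qed.

Lemma vec3E1 (a b c : R) : vec3 a b c 0 1 = b.
Proof. by rewrite mxE. Qed.

Lemma vec3E2 (a b c : R) : vec3 a b c 0 2 = c.
Proof. by rewrite mxE. Qed.

Definition vec3E := (vec3E0, vec3E1, vec3E2).

Lemma ord3P (P : 'I_3 -> Prop) : P 0 -> P 1 -> P 2 -> forall i, P i.
Proof.
move=> P0 P1 P2 [[|[|[|//]]] h].
- by rewrite (_ : Ordinal h = 0)//; exact: val_inj.
- by rewrite (_ : Ordinal h = 1)//; exact: val_inj.
- by rewrite (_ : Ordinal h = 2)//; exact: val_inj.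
Qed.

Lemma eq_vec3 x y : x 0 0 = y 0 0 -> x 0 1 = y 0 1 -> x 0 2 = y 0 2 -> x = y.
Proof. by move=> *; apply/rowP; apply: ord3P. Qed.

Lemma vec3_eta x : x = vec3 (x 0 0) (x 0 1) (x 0 2).
Proof. by apply: eq_vec3; rewrite vec3E. Qed.

Lemma cvg_mx (T : Type) (F : set_system T) {FF : Filter F} m n
    (M : T -> 'M[R]_(m, n)) (L : 'M[R]_(m, n)) :
  (forall i j, M t i j @[t --> F] --> L i j) -> M t @[t --> F] --> L.
Proof.
move=> ML A /nbhs_ballP[e /= e0 eA].
have : \forall t \near F, forall i j, ball (L i j) e (M t i j).
  apply: filter_forall => i; apply: filter_forall => j.
  by apply: (ML i j); exact: nbhsx_ballx.
by apply: filterS => t Mt; apply: eA.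
Qed.

Lemma continuous_vec3 (T : topologicalType) (a b c : T -> R) :
  continuous a -> continuous b -> continuous c ->
  continuous (fun t => vec3 (a t) (b t) (c t)).
Proof.
move=> ca cb cc t; apply: cvg_mx => i; rewrite ord1; apply: ord3P.
- by rewrite vec3E; under eq_fun do rewrite vec3E; exact: ca.
- by rewrite vec3E; under eq_fun do rewrite vec3E; exact: cb.
- by rewrite vec3E; under eq_fun do rewrite vec3E; exact: cc.
Qed.

Definition rad2 x : R := x 0 0 ^+ 2 + x 0 1 ^+ 2.

Lemma continuous_rad2 : continuous rad2.
Proof.
by apply: continuous_add; apply: continuous_mul; exact: coord_continuous.
Qed.

Lemma open_pipe : open (@pipe R).
Proof.
rewrite (_ : @pipe R = rad2 @^-1` [set t | t < 1])//.
apply: open_comp; last exact: lray_open.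
by move=> x _; exact: continuous_rad2.
Qed.

Lemma near_pipe x : pipe x -> \forall y \near x, pipe y.
Proof. by move=> px; apply: open_nbhs_nbhs; split => //; exact: open_pipe. Qed.

Lemma pipe_disk (y : R * R) (z : R) : pipe (vec3 y.1 y.2 z) <-> disk y.
Proof. by rewrite /pipe/= !vec3E. Qed.

Lemma disk_pipe x : pipe x -> disk (x 0 0, x 0 1).
Proof. by []. Qed.

(** Shrinking the distance to the axis moves a point of the closed cylinder to
    nearby interior points. *)
Lemma closed_pipe_closure x : rad2 x <= 1 -> closure (@pipe R) x.
Proof.
move=> x1 A /nbhs_ballP[e /= e0 eA].
pose s := e / (e + 1 + `|x 0 0| + `|x 0 1|).
have a0 := normr_ge0 (x 0 0); have a1 := normr_ge0 (x 0 1).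
have D0 : 0 < e + 1 + `|x 0 0| + `|x 0 1| by lra.
have s0 : 0 < s by rewrite divr_gt0.
have s1 : s < 1 by rewrite ltr_pdivrMr//; lra.
have se (a : R) : `|a| <= `|x 0 0| + `|x 0 1| -> `|s * a| < e.
  move=> ha; rewrite normrM gtr0_norm// mulrAC ltr_pdivrMr// ltr_pM2l//; lra.
exists (vec3 ((1 - s) * x 0 0) ((1 - s) * x 0 1) (x 0 2)); split.
  rewrite /pipe/= !vec3E !exprMn -mulrDr -/(rad2 x).
  have := addr_ge0 (sqr_ge0 (x 0 0)) (sqr_ge0 (x 0 1)); rewrite -/(rad2 x).
  by move=> r0; nra.
apply: eA; split => // i; rewrite ord1; apply: ord3P; rewrite vec3E /ball/=.
- by rewrite (_ : _ - _ = s * x 0 0); [apply: se; lra|ring].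
- by rewrite (_ : _ - _ = s * x 0 1); [apply: se; lra|ring].
- by rewrite subrr normr0.
Qed.

Lemma eq_on_closure f g : continuous f -> continuous g ->
  (forall x, pipe x -> f x = g x) -> forall x, rad2 x <= 1 -> f x = g x.
Proof.
move=> cf cg fg x /closed_pipe_closure.
have : closed [set x | f x - g x = 0].
  apply: ((continuous_closedP (fun x => f x - g x)).1 _ [set 0] (@closed_eq R 0)).
  exact: continuous_sub.
move=> /closure_id cl clx; apply/eqP; rewrite -subr_eq0; apply/eqP.
suff : [set x | f x - g x = 0] x by [].
by rewrite cl; apply: closure_subset clx => y py /=; rewrite fg// subrr.
Qed.

(** The nearest point of the closed cylinder. *)
Definition retract x : 'rV[R]_3 :=
  let r := Num.max 1 (cyl_radius x) in vec3 (x 0 0 / r) (x 0 1 / r) (x 0 2).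

Lemma continuous_retract : continuous retract.
Proof.
have c (i : 'I_3) : continuous (fun x : 'rV[R]_3 => x 0 i) by exact: coord_continuous.
have cr : continuous (fun x : 'rV[R]_3 => (Num.max 1 (cyl_radius x))^-1).
  have cc : continuous (@cyl_radius R).
    move=> x; apply: (@continuous_comp _ _ _ rad2 Num.sqrt); first exact: continuous_rad2.
    exact: sqrt_continuous.
  apply: continuous_inv; last by move=> x; rewrite gt_eqF// lt_max ltr01.
  by move=> x; apply: (@continuous_max _ _ (fun=> 1) (@cyl_radius R) x);
    [exact: continuous_const|exact: cc].
apply: continuous_vec3; last exact: c.
  exact: continuous_mul.
exact: continuous_mul.
Qed.

Lemma retract_id x : rad2 x <= 1 -> retract x = x.
Proof.
move=> x1; rewrite /retract max_l ?divr1 -?vec3_eta// /cyl_radius.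
by rewrite -(sqrtr1 R) ler_sqrt.
Qed.

Lemma retract_closure x : closure (@pipe R) (retract x).
Proof.
apply: closed_pipe_closure; rewrite /retract/= /rad2 !vec3E !expr_div_n -mulrDl.
have m0 : 0 < Num.max 1 (cyl_radius x) by rewrite lt_max ltr01.
have m1 : cyl_radius x <= Num.max 1 (cyl_radius x) by rewrite le_max lexx orbT.
rewrite ler_pdivrMr ?exprn_gt0// mul1r -/(rad2 x).
have r2 : rad2 x = cyl_radius x ^+ 2 by rewrite sqr_sqrtr// addr_ge0 ?sqr_ge0.
by rewrite r2 ler_sqr// ?nnegrE ?sqrtr_ge0 ?ltW.
Qed.

(** Extending by the value at the nearest point of the closed cylinder turns a
    function that is continuous up to the boundary into one that is continuous
    on all of space. *)
Lemma extend_from_closure g : {within closure (@pipe R), continuous g} ->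
  exists2 h, continuous h & forall x, pipe x -> h x = g x.
Proof.
move=> cg; exists (g \o retract); last first.
  by move=> x px /=; rewrite retract_id//; exact: ltW.
move=> x; apply: (@cvg_comp _ _ _ retract g _ (within (closure (@pipe R)) (nbhs (retract x)))).
  move=> A hA.
  have nx : nbhs x [set y | closure (@pipe R) (retract y) -> A (retract y)].
    exact: continuous_retract hA.
  by apply: filterS nx => y; apply; exact: retract_closure.
have := cg (retract x); rewrite /continuous_at.
by rewrite nbhs_subspace_in//; exact: retract_closure.
Qed.

End Space.

(** * Directional derivatives *)

Section Differentiation.
Context {R : realType} {V : normedModType R}.
Implicit Types (x v w : V) (f : V -> R).

(** Second differences live on small parallelograms at [x], which have to stay in
    the neighbourhood where derivatives are known. *)
Lemma near_parallelogram x v w (P : set V) : nbhs x P ->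
  exists2 d : R, 0 < d & forall s k : R, `|s| <= d -> `|k| <= d ->
    P (x + s *: v + k *: w).
Proof.
move=> /nbhs_ballP[r /= r0 rP].
pose M := 1 + `|v| + `|w|.
have v0 := normr_ge0 v; have w0 := normr_ge0 w.
have M0 : 0 < M by rewrite /M; lra.
exists (r / 2 / M); first by rewrite !divr_gt0.
move=> s k; rewrite !ler_pdivlMr// => hs hk.
apply: rP; rewrite -ball_normE/= opprD addrA opprD addrA subrr add0r -opprD normrN.
apply: (le_lt_trans (ler_normD _ _)); rewrite !normrZ.
have s0 := normr_ge0 s; have k0 := normr_ge0 k.
rewrite /M in hs hk.
have h1 : `|s| * `|v| + `|s| <= r / 2 by nra.
have h2 : `|k| * `|w| + `|k| <= r / 2 by nra.
have [s00|s00] := eqVneq s 0; last first.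
  have : 0 < `|s| by rewrite normr_gt0.
  by lra.
have [k00|k00] := eqVneq k 0; last first.
  have : 0 < `|k| by rewrite normr_gt0.
  by lra.
by rewrite s00 k00 normr0 !mul0r; lra.
Qed.

Lemma is_derive_line f x v (t d : R) : is_derive (x + t *: v) v f d ->
  is_derive t 1 (fun s : R => f (x + s *: v)) d.
Proof.
move=> [df <-].
have E : (fun h : R => h^-1 *: (((fun s : R => f (x + s *: v)) \o shift t) (h *: 1)
      - f (x + t *: v))) =
    (fun h : R => h^-1 *: ((f \o shift (x + t *: v)) (h *: v) - f (x + t *: v))).
  apply/funext => h /=; congr (_ *: (f _ - _)).
  by rewrite [h%:A]mulr1 scalerDl addrCA.
split; first by rewrite /derivable E.
by rewrite /derive E.
Qed.

Lemma is_derive_translate f x v k (d : R) : is_derive (x + k) v f d ->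
  is_derive x v (fun y => f (y + k)) d.
Proof.
move=> [df <-].
have E : (fun h : R => h^-1 *: (((fun y => f (y + k)) \o shift x) (h *: v) - f (x + k))) =
    (fun h : R => h^-1 *: ((f \o shift (x + k)) (h *: v) - f (x + k))).
  by apply/funext => h /=; rewrite addrA.
split; first by rewrite /derivable E.
by rewrite /derive E.
Qed.

Lemma MVT_unit (phi dphi : R -> R) :
  (forall s : R, 0 <= s <= 1 -> is_derive s 1 phi (dphi s)) ->
  exists2 s : R, 0 <= s <= 1 & phi 1 - phi 0 = dphi s.
Proof.
move=> dp.
have [||c] := @MVT R phi dphi 0 1 ltr01.
- by move=> s; rewrite in_itv/= => /andP[s0 s1]; apply: dp; rewrite !ltW.
- apply: derivable_within_continuous => s; rewrite in_itv/= => s01.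
  by have [] := dp s s01.
rewrite in_itv/= => /andP[c0 c1] ->; exists c; first by rewrite !ltW.
by rewrite subr0 mulr1.
Qed.

Lemma MVT_line f (df : V -> R) x v (h : R) :
  (forall s : R, 0 <= s <= 1 -> is_derive (x + (s * h) *: v) v f (df (x + (s * h) *: v))) ->
  exists2 s : R, 0 <= s <= 1 & f (x + h *: v) - f x = h * df (x + (s * h) *: v).
Proof.
move=> dfx.
have [|s s01 e] := @MVT_unit (fun s => f (x + (s * h) *: v))
  (fun s => h * df (x + (s * h) *: v)).
  move=> s s01.
  have d1 := is_derive_line (dfx s s01).
  have d2 : is_derive s 1 (fun s : R => s * h) h.
    apply: is_derive_eq (is_derive_mul (is_derive_id s 1) (is_derive_const h s 1)) _.
    by rewrite mul1r mulr0 addr0.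
  have := @is_derive1_comp _ (fun r : R => f (x + r *: v)) (fun s : R => s * h) s _ _ d1 d2.
  by rewrite mulrC.
by exists s => //; rewrite -e mul1r mul0r scale0r addr0.
Qed.

(** Directional derivatives are additive in the direction as soon as the one
    along [w] is continuous: move first along v, where only the derivative at [x]
    is used, then along w by the mean value theorem. *)
Lemma is_derive_add_dir f (df : V -> R) x v w (a b : R) :
  is_derive x v f a ->
  (\forall y \near x, is_derive y w f (df y)) -> {for x, continuous df} ->
  is_derive x (v + b *: w) f (a + b * df x).
Proof.
move=> [dfv <-] dfw cdf.
suff h : (fun h : R => h^-1 *: ((f \o shift x) (h *: (v + b *: w)) - f x)) @ 0^' -->
    'D_v f x + b * df x.
  split; first by apply/cvg_ex; exists ('D_v f x + b * df x).
  exact: cvg_lim h.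
have E : (fun h : R => h^-1 *: ((f \o shift x) (h *: (v + b *: w)) - f x)) =
   (fun h : R => h^-1 *: ((f \o shift x) (h *: v) - f x) +
     h^-1 *: (f (x + h *: v + (h * b) *: w) - f (x + h *: v))).
  apply/funext => h /=; rewrite -scalerDr; congr (_ *: _).
  rewrite scalerDr scalerA [h *: v + x]addrC.
  have -> : h *: v + (h * b) *: w + x = x + h *: v + (h * b) *: w.
    by rewrite addrC addrA.
  by ring.
rewrite E; apply: cvgD; first exact: dfv.
apply/cvgrPdist_le => e e0.
have b1 : 0 < `|b| + 1 by rewrite ltr_pwDr.
have : \forall y \near x, is_derive y w f (df y) /\ `|df x - df y| <= e / (`|b| + 1).
  apply: filterI => //.
  by move/cvgrPdist_le : cdf => /(_ _ (divr_gt0 e0 b1)).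
move=> /(@near_parallelogram x v w _)[d d0 dP].
near=> h.
have h0 : h != 0 by near: h; exact: nbhs_dnbhs_neq.
have hd : `|h| * (`|b| + 1) <= d.
  rewrite -ler_pdivlMr//; near: h; apply: dnbhs0_le; exact: divr_gt0.
have hd1 : `|h| <= d.
  by apply: le_trans hd; rewrite ler_peMr// lerDr.
have hb s : 0 <= s <= 1 -> `|s * (h * b)| <= d.
  move=> /andP[s0 s1]; rewrite !normrM (ger0_norm s0).
  apply: le_trans hd; rewrite -[leRHS]mul1r; apply: ler_pM => //.
  by rewrite ler_wpM2l// lerDl.
have [|s s01 ->] := @MVT_line f df (x + h *: v) w (h * b).
  by move=> s s01; have [] := dP h (s * (h * b)) hd1 (hb s s01).
have [_] := dP h (s * (h * b)) hd1 (hb s s01).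
set y := x + _ + _ => hy.
rewrite -mulrA scalerA mulVf// scale1r -mulrBr normrM.
apply: (@le_trans _ _ (`|b| * (e / (`|b| + 1)))); first by rewrite ler_wpM2l.
by rewrite mulrA ler_pdivrMr// mulrC ler_wpM2l ?ltW// ltrDl.
Unshelve. all: by end_near. Qed.

(** Two applications of the mean value theorem, in either order, express the same
    second difference through either mixed derivative at points that tend to
    [x]. *)
Lemma schwarz f (fv fw fvw fwv : V -> R) x v w :
  (\forall y \near x, is_derive y v f (fv y)) ->
  (\forall y \near x, is_derive y w f (fw y)) ->
  (\forall y \near x, is_derive y w fv (fvw y)) ->
  (\forall y \near x, is_derive y v fw (fwv y)) ->
  {for x, continuous fvw} -> {for x, continuous fwv} ->
  fvw x = fwv x.
Proof.
move=> dv dw dvw dwv cvw cwv; apply/eqP; rewrite -subr_eq0 -normr_le0.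
apply/ler_addgt0Pl => e e0; rewrite addr0.
have e2 : 0 < e / 2 by rewrite divr_gt0.
have nxy : \forall y \near x, [/\ is_derive y v f (fv y), is_derive y w f (fw y),
    is_derive y w fv (fvw y), is_derive y v fw (fwv y) &
    `|fvw x - fvw y| <= e / 2 /\ `|fwv x - fwv y| <= e / 2].
  move/cvgrPdist_le : cvw => /(_ _ e2) cvw.
  move/cvgrPdist_le : cwv => /(_ _ e2) cwv.
  by near=> y; split; [| | | |split]; near: y.
have [d d0 dP] := @near_parallelogram x v w _ nxy.
have sd (s : R) : 0 <= s <= 1 -> `|s * d| <= d.
  by move=> /andP[s0 s1]; rewrite normrM (gtr0_norm d0) (ger0_norm s0) ler_piMl// ltW.
have dd : `|d| <= d by rewrite gtr0_norm.
have z0 : `|0 : R| <= d by rewrite normr0 ltW.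
(* the second difference of f, first along v and then along w *)
have [s s01 es] : exists2 s : R, 0 <= s <= 1 &
  (f (x + d *: v + d *: w) - f (x + d *: v)) - (f (x + d *: w) - f x) =
  d * (fv (x + (s * d) *: v + d *: w) - fv (x + (s * d) *: v)).
  have := @MVT_line (fun y => f (y + d *: w) - f y)
    (fun y => fv (y + d *: w) - fv y) x v d.
  rewrite addrAC; case => [s s01|s s01 ->]; last by exists s.
  apply: is_derive_add.
    by apply: is_derive_translate; have [] := dP (s * d) d (sd s s01) dd.
  apply: is_derive_opp; have [+ _ _ _ _] := dP (s * d) 0 (sd s s01) z0.
  by rewrite scale0r addr0.
have [k k01 ek] := @MVT_line fv fvw (x + (s * d) *: v) w d
  (fun k k01 => let: And5 _ _ h _ _ := dP (s * d) (k * d) (sd s s01) (sd k k01) in h).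
have [s' s01' es'] : exists2 s : R, 0 <= s <= 1 &
  (f (x + d *: v + d *: w) - f (x + d *: w)) - (f (x + d *: v) - f x) =
  d * (fw (x + d *: v + (s * d) *: w) - fw (x + (s * d) *: w)).
  have := @MVT_line (fun y => f (y + d *: v) - f y)
    (fun y => fw (y + d *: v) - fw y) x w d.
  rewrite [x + d *: v + _]addrAC; case => [s1 s101|s1 s101 ->]; last first.
    by exists s1 => //; rewrite addrAC.
  apply: is_derive_add.
    apply: is_derive_translate; have [] := dP d (s1 * d) dd (sd s1 s101).
    by rewrite addrAC.
  apply: is_derive_opp; have [_ + _ _ _] := dP 0 (s1 * d) z0 (sd s1 s101).
  by rewrite scale0r addr0.
have [k' k01' ek'] := @MVT_line fw fwv (x + (s' * d) *: w) v d
  (fun k k01 => let: And5 _ _ _ h _ := dP (k * d) (s' * d) (sd k k01) (sd s' s01') in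
     eq_rect _ (fun z => is_derive z v fw (fwv z)) h _ (addrAC _ _ _)).
have [_ _ _ _ [c1 _]] := dP (s * d) (k * d) (sd s s01) (sd k k01).
have [_ _ _ _ [_ c2]] := dP (k' * d) (s' * d) (sd k' k01') (sd s' s01').
have E : fvw (x + (s * d) *: v + (k * d) *: w) = fwv (x + (s' * d) *: w + (k' * d) *: v).
  have dn0 : d != 0 by rewrite gt_eqF.
  apply: (mulfI dn0); apply: (mulfI dn0).
  rewrite -ek -ek' -es [x + (s' * d) *: w + d *: v]addrAC -es'; ring.
rewrite addrAC in c2.
rewrite [_ - _](_ : _ = (fvw x - fvw (x + (s * d) *: v + (k * d) *: w)) -
  (fwv x - fwv (x + (s' * d) *: w + (k' * d) *: v))); last by rewrite E; ring.
by apply: (le_trans (ler_normB _ _)); lra.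
Unshelve. all: by end_near. Qed.

End Differentiation.

(** * Fields smooth up to the wall *)

Section Fields.
Context {R : realType}.
Implicit Types (x y v : 'rV[R]_3) (f g h : 'rV[R]_3 -> R) (i j : 'I_3).
Local Notation "''e_' i" := (delta_mx 0 i : 'rV[R]_3) (at level 8, i at level 2).

(** Continuity up to the wall, in the form of a continuous function on all of
    space that agrees with [f] in the open cylinder. *)
Definition cext f : Prop :=
  exists2 g : 'rV[R]_3 -> R, continuous g & forall x, pipe x -> g x = f x.

(** The class C^n up to the wall; an explicit order makes its closure under sums,
    products and radial means provable by induction. *)
Fixpoint Ck (n : nat) f : Prop :=
  cext f /\
  if n is m.+1 then
    forall i, (forall x, pipe x -> derivable f x 'e_i) /\ Ck m (pd i f)
  else True.

Lemma eq_cext f g : (forall x, pipe x -> f x = g x) -> cext f -> cext g.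
Proof. by move=> fg [h ch hf]; exists h => // x px; rewrite hf// fg. Qed.

Lemma cext_continuous f x : cext f -> pipe x -> {for x, continuous f}.
Proof.
move=> [g cg gf] px.
have : {near x, g =1 f} by apply: filterS (near_pipe px) => y; exact: gf.
by move=> gfx; apply: (cvg_trans (near_eq_cvg gfx)); rewrite -gf//; exact: cg.
Qed.

Lemma cextD f g : cext f -> cext g -> cext (fun x => f x + g x).
Proof.
move=> [h ch hf] [k ck kg]; exists (fun x => h x + k x).
  exact: continuous_add.
by move=> x px; rewrite hf// kg.
Qed.

Lemma cextM f g : cext f -> cext g -> cext (fun x => f x * g x).
Proof.
move=> [h ch hf] [k ck kg]; exists (fun x => h x * k x).
  exact: continuous_mul.
by move=> x px; rewrite hf// kg.
Qed.

Lemma continuous_cext f : continuous f -> cext f.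
Proof. by exists f. Qed.

Lemma Ck_cext n f : Ck n f -> cext f.
Proof. by case: n => [|n] []. Qed.

Lemma Ck_derivable n f i x : Ck n.+1 f -> pipe x -> derivable f x 'e_i.
Proof. by move=> [_ /(_ i)[+ _]]; exact. Qed.

Lemma Ck_is_derive n f i x : Ck n.+1 f -> pipe x -> is_derive x 'e_i f (pd i f x).
Proof. by move=> Cf px; apply/derivableP; exact: Ck_derivable Cf px. Qed.

Lemma Ck_pd n f i : Ck n.+1 f -> Ck n (pd i f).
Proof. by move=> [_ /(_ i)[]]. Qed.

Lemma CkW n f : Ck n.+1 f -> Ck n f.
Proof.
elim: n f => [|n IH] f; first by move=> /Ck_cext.
move=> [cf df]; split => // i; have [dfi Cfi] := df i; split => //.
exact: IH.
Qed.

Lemma eq_pd f g i x : (forall y, pipe y -> f y = g y) -> pipe x ->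
  pd i f x = pd i g x.
Proof.
move=> fg px; apply: near_eq_derive.
by apply: filterS (near_pipe px) => y; exact: fg.
Qed.

Lemma eq_Ck n f g : (forall x, pipe x -> f x = g x) -> Ck n f -> Ck n g.
Proof.
elim: n f g => [|n IH] f g fg [cf df]; split; try exact: eq_cext cf => //.
  by [].
move=> i; have [dfi Cfi] := df i; split.
  move=> x px; apply: near_eq_derivable (dfi x px).
  by apply: filterS (near_pipe px) => y; exact: fg.
by apply: IH Cfi => x px; exact: eq_pd.
Qed.

Lemma pd_is_derive f i x d : is_derive x 'e_i f d -> pd i f x = d.
Proof. by case. Qed.

Lemma pdD n f g i x : Ck n.+1 f -> Ck n.+1 g -> pipe x ->
  pd i (fun y => f y + g y) x = pd i f x + pd i g x.
Proof.
move=> Cf Cg px; apply: pd_is_derive.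
exact: (is_derive_add (Ck_is_derive i Cf px) (Ck_is_derive i Cg px)).
Qed.

Lemma pdM n f g i x : Ck n.+1 f -> Ck n.+1 g -> pipe x ->
  pd i (fun y => f y * g y) x = pd i f x * g x + f x * pd i g x.
Proof.
move=> Cf Cg px; apply: pd_is_derive.
exact: (is_derive_mul (Ck_is_derive i Cf px) (Ck_is_derive i Cg px)).
Qed.

Lemma pdN n f i x : Ck n.+1 f -> pipe x -> pd i (fun y => - f y) x = - pd i f x.
Proof.
by move=> Cf px; apply: pd_is_derive; exact: (is_derive_opp (Ck_is_derive i Cf px)).
Qed.

Lemma pd_cst (c : R) i x : pd i (fun=> c) x = 0.
Proof. by apply: pd_is_derive; exact: is_derive_const. Qed.

Lemma is_derive_coord i j x : is_derive x 'e_i (fun y => y 0 j) (i == j)%:R.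
Proof.
have E : (fun h : R => h^-1 *: (((fun y => y 0 j) \o shift x) (h *: 'e_i) - x 0 j)) =
   (fun h : R => h^-1 *: (h *: (i == j)%:R)).
  apply/funext => h /=; congr (_ *: _); rewrite !mxE /= eq_sym.
  by rewrite addrK eq_sym.
have : (fun h : R => h^-1 *: (h *: (i == j)%:R : R)) @ 0^' --> ((i == j)%:R : R).
  apply: (@cvg_trans _ ((fun=> (i == j)%:R : R) @ (0 : R)^')); last exact: cvg_cst.
  apply: near_eq_cvg; near=> h.
  have h0 : h != 0 by near: h; exact: nbhs_dnbhs_neq.
  by rewrite scalerA mulVf// scale1r.
rewrite -E => lim; split; first by apply/cvg_ex; exists (i == j)%:R.
exact: cvg_lim lim.
Unshelve. all: by end_near. Qed.

Lemma pd_coord i j x : pd i (fun y => y 0 j) x = (i == j)%:R.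
Proof. by apply: pd_is_derive; exact: is_derive_coord. Qed.

Lemma Ck_cst n (c : R) : Ck n (fun=> c).
Proof.
elim: n c => [|n IH] c; split => //; try exact/continuous_cext/continuous_const.
move=> i; split; first by move=> x _; exact: derivable_cst.
by apply: (eq_Ck _ (IH 0)) => x _; rewrite pd_cst.
Qed.

Lemma CkD n f g : Ck n f -> Ck n g -> Ck n (fun x => f x + g x).
Proof.
elim: n f g => [|n IH] f g Cf Cg.
  by split => //; apply: cextD; [exact: Ck_cext Cf|exact: Ck_cext Cg].
split; first by apply: cextD; [exact: Ck_cext Cf|exact: Ck_cext Cg].
move=> i; split.
  move=> x px; have := is_derive_add (Ck_is_derive i Cf px) (Ck_is_derive i Cg px).
  by case.
apply: (@eq_Ck n (fun x => pd i f x + pd i g x)).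
  by move=> x px; rewrite (pdD i Cf Cg px).
by apply: IH; exact: Ck_pd.
Qed.

Lemma CkM n f g : Ck n f -> Ck n g -> Ck n (fun x => f x * g x).
Proof.
elim: n f g => [|n IH] f g Cf Cg.
  by split => //; apply: cextM; [exact: Ck_cext Cf|exact: Ck_cext Cg].
split; first by apply: cextM; [exact: Ck_cext Cf|exact: Ck_cext Cg].
move=> i; split.
  move=> x px; have := is_derive_mul (Ck_is_derive i Cf px) (Ck_is_derive i Cg px).
  by case.
apply: (@eq_Ck n (fun x => pd i f x * g x + f x * pd i g x)).
  by move=> x px; rewrite (pdM i Cf Cg px).
by apply: CkD; apply: IH; (try exact: Ck_pd); exact: CkW.
Qed.

Lemma CkN n f : Ck n f -> Ck n (fun x => - f x).
Proof.
move=> Cf; apply: (eq_Ck _ (CkM (Ck_cst n (-1)) Cf)) => x _.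
by rewrite mulN1r.
Qed.

Lemma Ck_coord n j : Ck n (fun x => x 0 j).
Proof.
have ce : cext (fun x => x 0 j) by apply: continuous_cext; exact: coord_continuous.
case: n => [|n]; split => // i; split.
  by move=> x _; have [] := is_derive_coord i j x.
by apply: (eq_Ck _ (Ck_cst n (i == j)%:R)) => x _; rewrite pd_coord.
Qed.

Lemma smooth_iter_pd s f : smooth_up_to_boundary (@pipe R) f ->
  smooth_up_to_boundary (@pipe R) (iter_pd s f).
Proof.
move=> sf t; have := sf (t ++ s).
by rewrite /iter_pd foldr_cat.
Qed.

Lemma smooth_Ck n f : smooth_up_to_boundary (@pipe R) f -> Ck n f.
Proof.
elim: n f => [|n IH] f sf; have [df [g [cg gf]]] := sf [::].
  split => //; have [h ch hg] := extend_from_closure cg.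
  by exists h => // x px; rewrite hg// gf.
split.
  have [h ch hg] := extend_from_closure cg.
  by exists h => // x px; rewrite hg// gf.
move=> i; split; first exact: df.
by apply: IH; exact: (smooth_iter_pd [:: i] sf).
Qed.

Lemma pd_comm f i j x : Ck 2 f -> pipe x -> pd i (pd j f) x = pd j (pd i f) x.
Proof.
move=> Cf px; have np := near_pipe px.
apply: (@schwarz R _ f (pd j f) (pd i f) (pd i (pd j f)) (pd j (pd i f)) x 'e_j 'e_i).
- by apply: filterS np => y py; exact: Ck_is_derive Cf py.
- by apply: filterS np => y py; exact: Ck_is_derive Cf py.
- by apply: filterS np => y py; exact: Ck_is_derive (Ck_pd j Cf) py.
- by apply: filterS np => y py; exact: Ck_is_derive (Ck_pd i Cf) py.
- by apply: cext_continuous px; exact: Ck_cext (Ck_pd i (Ck_pd j Cf)).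
- by apply: cext_continuous px; exact: Ck_cext (Ck_pd j (Ck_pd i Cf)).
Qed.

(** Continuous partial derivatives determine all horizontal directional
    derivatives. *)
Lemma is_derive_horizontal f x (a b : R) : Ck 1 f -> pipe x ->
  is_derive x (vec3 a b 0) f (a * pd 0 f x + b * pd 1 f x).
Proof.
move=> Cf px; have np := near_pipe px.
have step i v d c : is_derive x v f d -> is_derive x (v + c *: 'e_i) f (d + c * pd i f x).
  move=> dv; apply: is_derive_add_dir => //.
    by apply: filterS np => y py; exact: Ck_is_derive Cf py.
  by apply: cext_continuous px; exact: Ck_cext (Ck_pd i Cf).
have := step 1 _ _ b (step 0 _ _ a (is_derive0 f x)).
rewrite !add0r => h.
have -> : vec3 a b 0 = a *: 'e_0 + b *: 'e_1.
  by apply: eq_vec3; rewrite vec3E !mxE/= ?mulr1 ?mulr0 ?addr0 ?add0r.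
exact: h.
Qed.

End Fields.

(** * Integrals over cross-sections *)

Section CrossSections.
Context {R : realType}.
Implicit Types (x v : 'rV[R]_3) (f g h : 'rV[R]_3 -> R) (z : R).
Local Notation "''e_' i" := (delta_mx 0 i : 'rV[R]_3) (at level 8, i at level 2).

Lemma disk_slice (y : R * R) : disk y -> forall z, pipe (vec3 y.1 y.2 z).
Proof. by move=> dy z; exact/pipe_disk. Qed.

Definition sint f z : R := dint (fun y : R * R => f (vec3 y.1 y.2 z)).

Lemma slice_continuous g z : continuous g ->
  continuous (fun y : R * R => g (vec3 y.1 y.2 z)).
Proof.
move=> cg y; apply: (@continuous_comp _ _ _ (fun y : R * R => vec3 y.1 y.2 z) g).
  apply: continuous_vec3; [exact: continuous_fst2|exact: continuous_snd2|exact: continuous_const].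
exact: cg.
Qed.

Lemma planar_slice f z : cext f -> planar (fun y : R * R => f (vec3 y.1 y.2 z)).
Proof.
move=> [g cg gf]; exists (fun y : R * R => g (vec3 y.1 y.2 z)).
  exact: slice_continuous.
by move=> y /disk_slice dy; rewrite gf.
Qed.

Lemma eq_sint f g z : (forall x, pipe x -> f x = g x) -> sint f z = sint g z.
Proof. by move=> fg; apply: eq_dint => y /disk_slice dy; rewrite fg. Qed.

Lemma sintD f g z : cext f -> cext g ->
  sint (fun x => f x + g x) z = sint f z + sint g z.
Proof. by move=> cf cg; apply: dintD; exact: planar_slice. Qed.

Lemma sintZ c f z : cext f -> sint (fun x => c * f x) z = c * sint f z.
Proof. by move=> cf; apply: dintZ; exact: planar_slice. Qed.

Lemma sintN f z : cext f -> sint (fun x => - f x) z = - sint f z.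
Proof. by move=> cf; apply: dintN; exact: planar_slice. Qed.

Lemma sint_cst c z : sint (fun=> c) z = c * dint (fun=> 1).
Proof.
rewrite /sint -dintZ; last exact: planar_cst.
by apply: eq_dint => y _; rewrite mulr1.
Qed.

Lemma sint_ge0 f z : (forall x, pipe x -> 0 <= f x) -> 0 <= sint f z.
Proof. by move=> f0; apply: dint_ge0 => y /disk_slice py; exact: f0. Qed.

Lemma le_sint f g z : cext f -> cext g -> (forall x, pipe x -> f x <= g x) ->
  sint f z <= sint g z.
Proof.
move=> cf cg fg; apply: le_dint; [exact: planar_slice|exact: planar_slice|].
by move=> y /disk_slice py; exact: fg.
Qed.

Lemma norm_sint_le k h z : cext k -> cext h -> (forall x, pipe x -> `|k x| <= h x) ->
  `|sint k z| <= sint h z.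
Proof.
move=> ck ch kh; rewrite ler_norml -mulN1r -sintZ//.
apply/andP; split; apply: le_sint => //.
- by apply: cextM => //; exact: (Ck_cext (Ck_cst 0 (-1))).
- by move=> x /kh; rewrite mulN1r ler_norml => /andP[].
- by move=> x /kh; rewrite ler_norml => /andP[].
Qed.

Lemma sint_eq0 f : cext f -> (forall x, pipe x -> 0 <= f x) ->
  (forall z, sint f z = 0) -> forall x, pipe x -> f x = 0.
Proof.
move=> cf f0 if0 x px; rewrite (vec3_eta x).
have ps := planar_slice (x 0 2) cf.
have ge0 (y : R * R) : disk y -> 0 <= f (vec3 y.1 y.2 (x 0 2)).
  by move=> /disk_slice py; exact: f0.
exact: (dint_eq0 ps ge0 (if0 (x 0 2)) (disk_pipe px)).
Qed.

(** The fields concerned are defined in the open cylinder only, so their boundary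
    values are those of a continuous extension. *)
Definition lateral_zero h : Prop :=
  exists2 k : 'rV[R]_3 -> R, continuous k &
    (forall x, pipe x -> k x = h x) /\ (forall x, pipe_boundary x -> k x = 0).

Lemma eq_lateral_zero h k : (forall x, pipe x -> h x = k x) ->
  lateral_zero h -> lateral_zero k.
Proof.
by move=> hk [l cl [lh l0]]; exists l => //; split => // x px; rewrite lh// hk.
Qed.

Lemma lateral_zeroD h k : lateral_zero h -> lateral_zero k ->
  lateral_zero (fun x => h x + k x).
Proof.
move=> [l cl [lh l0]] [m cm [mk m0]]; exists (fun x => l x + m x).
  exact: continuous_add.
by split => x bx; [rewrite lh// mk|rewrite l0// m0// addr0].
Qed.

Lemma lateral_zeroM f h : cext f -> lateral_zero h ->
  lateral_zero (fun x => f x * h x).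
Proof.
move=> [g cg gf] [l cl [lh l0]]; exists (fun x => g x * l x).
  exact: continuous_mul.
by split => x bx; [rewrite lh// gf|rewrite l0// mulr0].
Qed.

Let slice_derive f g i x : Ck 1 f -> pipe x -> (forall x, pipe x -> g x = f x) ->
  is_derive (x 0 i) 1 (fun t : R => g (x + (t - x 0 i) *: 'e_i)) (pd i f x).
Proof.
move=> Cf px gf.
have d0 : is_derive (0 : R) 1 (fun t : R => g (x + t *: 'e_i)) (pd i f x).
  apply: is_derive_line; rewrite scale0r addr0.
  apply: near_eq_is_derive (Ck_is_derive i Cf px).
  by apply: filterS (near_pipe px) => y /gf.
have := @is_derive_translate _ R^o (fun t : R => g (x + t *: 'e_i)) (x 0 i) 1 (- x 0 i) (pd i f x).
by rewrite subrr; exact.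
Qed.

(** The condition on the normal component [b] concerns a single height, which is
    what a field built from the wall value at that height satisfies. *)
Lemma sint_divergence_slice f1 f2 b z : Ck 1 f1 -> Ck 1 f2 -> continuous b ->
  (forall x, pipe x -> b x = x 0 0 * f1 x + x 0 1 * f2 x) ->
  (forall x, pipe_boundary x -> x 0 2 = z -> b x = 0) ->
  sint (fun x => pd 0 f1 x + pd 1 f2 x) z = 0.
Proof.
move=> C1 C2 cb bf b0.
have [g1 cg1 gf1] := Ck_cext C1; have [g2 cg2 gf2] := Ck_cext C2.
have [k1 ck1 kf1] := Ck_cext (Ck_pd 0 C1); have [k2 ck2 kf2] := Ck_cext (Ck_pd 1 C2).
pose s (g : 'rV[R]_3 -> R) (y : R * R) := g (vec3 y.1 y.2 z).
transitivity (dint (fun y => s k1 y + s k2 y)).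
  by apply: eq_dint => y /disk_slice py; rewrite /s kf1// kf2.
apply: (@dint_divergence _ (s g1) (s g2)); rewrite /s; try exact: slice_continuous.
- move=> y /disk_slice py; rewrite kf1//.
  have := slice_derive 0 C1 (py z) gf1.
  rewrite vec3E (_ : (fun _ => _) = (fun t : R => g1 (vec3 t y.2 z)))//.
  apply/funext => t; congr g1; apply: eq_vec3; rewrite !mxE/= ?mulr1 ?mulr0 ?addr0//.
  by rewrite addrC subrK.
- move=> y /disk_slice py; rewrite kf2//.
  have := slice_derive 1 C2 (py z) gf2.
  rewrite vec3E (_ : (fun _ => _) = (fun t : R => g2 (vec3 y.1 t z)))//.
  apply/funext => t; congr g2; apply: eq_vec3; rewrite !mxE/= ?mulr1 ?mulr0 ?addr0//.
  by rewrite addrC subrK.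
- move=> y y1.
  have := @eq_on_closure _ (fun x => x 0 0 * g1 x + x 0 1 * g2 x) b _ cb _ (vec3 y.1 y.2 z).
  rewrite /rad2 !vec3E y1 lexx => ->//.
  + by apply: b0; rewrite /pipe_boundary/= ?vec3E.
  + by apply: continuous_add; apply: continuous_mul => //; exact: coord_continuous.
  + by move=> x px; rewrite bf// gf1// gf2.
Qed.

Lemma sint_divergence f1 f2 z : Ck 1 f1 -> Ck 1 f2 ->
  lateral_zero (fun x => x 0 0 * f1 x + x 0 1 * f2 x) ->
  sint (fun x => pd 0 f1 x + pd 1 f2 x) z = 0.
Proof.
move=> C1 C2 [b cb [bf b0]].
by apply: (sint_divergence_slice C1 C2 cb bf) => x /b0.
Qed.

Lemma cext_bounded_slab f a b : cext f ->
  exists M : R, forall x, pipe x -> a <= x 0 2 <= b -> `|f x| <= M.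
Proof.
move=> [g cg gf].
pose B (i : 'I_3) : set R := if i == 2 then `[a, b]%classic else `[-1, 1]%classic.
have cB : compact [set v : 'rV[R]_3 | forall i, B i (v ord0 i)].
  by apply: rV_compact => i; rewrite /B; case: ifP => _; exact: segment_compact.
have /compact_bounded[M [_ gM]] : compact (g @` [set v : 'rV[R]_3 | forall i, B i (v ord0 i)]).
  by apply: continuous_compact => //; exact: continuous_subspaceT.
exists (`|M| + 1) => x px xab; rewrite -gf//.
apply: gM; first by rewrite (le_lt_trans (ler_norm _))// ltrDl.
exists x => //; have [/= h1 h2] := disk_sub_square (disk_pipe px).
by apply: ord3P; rewrite /B/= ?in_itv.
Qed.

(** Continuity up to the wall bounds the axial derivative on a slab of height two,
    which dominates the difference quotients. *)
Lemma is_derive_sint f z : Ck 1 f -> is_derive z 1 (sint f) (sint (pd 2 f) z).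
Proof.
move=> Cf.
have [M fM] := cext_bounded_slab (z - 1) (z + 1) (Ck_cext (Ck_pd 2 Cf)).
apply: (@is_derive_dint _ (fun z y => f (vec3 y.1 y.2 z)) (fun z y => pd 2 f (vec3 y.1 y.2 z)) z M).
- by move=> w; apply: planar_slice; exact: Ck_cext Cf.
- move=> w y /disk_slice py.
  have := slice_derive 2 Cf (py w) (fun _ _ => erefl).
  rewrite vec3E (_ : (fun _ => _) = (fun t : R => f (vec3 y.1 y.2 t)))//.
  apply/funext => t; congr f; apply: eq_vec3; rewrite !mxE/= ?mulr1 ?mulr0 ?addr0//.
  by rewrite addrC subrK.
- move=> w y /andP[w1 w2] /disk_slice py; apply: fM; first exact: py w.
  by rewrite vec3E !ltW.
Qed.

End CrossSections.

(** * Radial means *)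

Section RadialMeans.
Context {R : realType}.
Local Notation leb := (@lebesgue_measure R).
Implicit Types (x : 'rV[R]_3) (f g : 'rV[R]_3 -> R) (s : R).

Definition dilate s x : 'rV[R]_3 := vec3 (s * x 0 0) (s * x 0 1) (x 0 2).

(** For k = 1, the horizontal position times this mean is a field with horizontal
    divergence [f] ([radial_mean_euler]); the other powers appear when the mean is
    differentiated. *)
Definition radial_mean (k : nat) f x : R :=
  \int[leb]_(s in `]0, 1[) (s ^+ k * f (dilate s x)).

Lemma pipe_dilate s x : 0 < s < 1 -> rad2 x <= 1 -> pipe (dilate s x).
Proof.
move=> /andP[s0 s1] x1; rewrite /pipe/= !vec3E !exprMn -mulrDr -/(rad2 x).
have : s ^+ 2 < 1 by rewrite expr_lt1// ltW.
have : 0 <= s ^+ 2 by exact: sqr_ge0.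
by move: (s ^+ 2) (rad2 x) x1 => a b *; nra.
Qed.

Lemma continuous_dilate_s x : continuous (fun s => dilate s x).
Proof.
by apply: continuous_vec3; [apply: continuous_mul|apply: continuous_mul|];
  by [exact: continuous_const|move=> s; exact: cvg_id].
Qed.

Let unit_measure : leb (`]0, 1[%classic : set R) = 1%:E.
Proof. by rewrite lebesgue_measure_itv/= lte_fin ltr01 oppr0 adde0. Qed.

Lemma continuous_unit_integrable (h : R -> R) : continuous h ->
  leb.-integrable (`]0, 1[%classic : set R) (EFin \o h).
Proof.
move=> ch.
have : leb.-integrable (`[0, 1]%classic : set R) (EFin \o h).
  apply: continuous_compact_integrable; first exact: segment_compact.
  exact: continuous_subspaceT.
apply: integrableS; [exact: measurable_itv|exact: measurable_itv|].
by apply: subset_itvW.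
Qed.

Lemma continuous_radial_integrand k g x : continuous g ->
  continuous (fun s => s ^+ k * g (dilate s x)).
Proof.
move=> cg; apply: continuous_mul; first exact: exprn_continuous.
move=> s; apply: continuous_comp; [exact: continuous_dilate_s|exact: cg].
Qed.

Lemma radial_mean_integrable k f x : cext f -> rad2 x <= 1 ->
  leb.-integrable (`]0, 1[%classic : set R) (EFin \o (fun s => s ^+ k * f (dilate s x))).
Proof.
move=> [g cg gf] x1.
have := continuous_unit_integrable (@continuous_radial_integrand k _ x cg).
apply: eq_integrable => // s /set_mem; rewrite /= in_itv/= => s01.
by rewrite gf//; exact: pipe_dilate.
Qed.

Lemma eq_radial_mean k f g x : (forall y, pipe y -> f y = g y) -> rad2 x <= 1 ->
  radial_mean k f x = radial_mean k g x.
Proof.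
move=> fg x1; apply: eq_Rintegral => s /set_mem; rewrite /= in_itv/= => s01.
by rewrite fg//; exact: pipe_dilate.
Qed.

Let unit_power_le k s : 0 < s < 1 -> `|s ^+ k| <= 1.
Proof.
move=> /andP[/ltW s0 /ltW s1]; rewrite ger0_norm; last exact: exprn_ge0.
exact: exprn_ile1.
Qed.

Lemma norm_unit_integral_le (h : R -> R) (M : R) :
  leb.-integrable (`]0, 1[%classic : set R) (EFin \o h) ->
  (forall s, 0 < s < 1 -> `|h s| <= M) -> `|\int[leb]_(s in `]0, 1[) h s| <= M.
Proof.
move=> ih hM; apply: (le_trans (le_normr_Rintegral _ ih)) => //.
apply: (@le_trans _ _ (\int[leb]_(s in `]0, 1[) M)).
  apply: le_Rintegral => //.
  - exact: integrable_norm.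
  - by apply: continuous_unit_integrable; exact: continuous_const.
rewrite Rintegral_cst// [X in _ * X](_ : _ = 1) ?mulr1//.
exact: (congr1 fine unit_measure).
Qed.

Lemma radial_mean_le k f x M : cext f -> (forall y, pipe y -> `|f y| <= M) ->
  rad2 x <= 1 -> `|radial_mean k f x| <= M.
Proof.
move=> cf fM x1; apply: norm_unit_integral_le; first exact: radial_mean_integrable.
move=> s s01; rewrite normrM.
have py := pipe_dilate s01 x1.
by rewrite -[leRHS]mul1r ler_pM// ?fM// unit_power_le.
Qed.

(** Uniform continuity on compact segments makes the mean of a continuous
    function continuous. *)
Lemma continuous_radial_mean k g : continuous g -> continuous (radial_mean k g).
Proof.
move=> cg x; apply/(@cvgrPdist_le _ _ _ (nbhs (x : 'rV[R]_3))) => e e0.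
have near_unif : \forall y \near x,
    `[0, 1]%classic `<=` [set s : R | `|g (dilate s x) - g (dilate s y)| <= e].
  have /compact_near_coveringP := @segment_compact R 0 1.
  move=> /(_ _ (nbhs x) (fun y s => `|g (dilate s x) - g (dilate s y)| <= e) _); apply.
  move=> s _.
  pose G (sy : R * 'rV[R]_3) := g (dilate sy.1 sy.2).
  have cG : continuous G.
    move=> sy; apply: continuous_comp; last exact: cg.
    have c1 : continuous (fun sy : R * 'rV[R]_3 => sy.1) by case=> a b; exact: cvg_fst.
    have c2 : continuous (fun sy : R * 'rV[R]_3 => sy.2) by case=> a b; exact: cvg_snd.
    have c3 i : continuous (fun sy : R * 'rV[R]_3 => sy.2 0 i).
      move=> sy'; apply: (@continuous_comp _ _ _ (fun sy : R * 'rV[R]_3 => sy.2)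
        (fun y : 'rV[R]_3 => y 0 i)); [exact: c2|exact: coord_continuous].
    by apply: continuous_vec3 => //; exact: continuous_mul.
  have e2 : 0 < e / 2 by lra.
  have n1 : \forall sy \near (s, x), `|G (s, x) - G sy| <= e / 2.
    by move/cvgrPdist_le : (cG (s, x)) => /(_ _ e2).
  have n2 : \forall s' \near s, `|G (s, x) - G (s', x)| <= e / 2.
    have c4 : continuous (fun s' : R => g (dilate s' x)).
      by move=> s'; apply: (@continuous_comp _ _ _ (fun s' => dilate s' x) g);
        [exact: continuous_dilate_s|exact: cg].
    by move/cvgrPdist_le : (c4 s) => /(_ _ e2).
  case: n1 => -[/= A B] [/= As Bx] AB.
  exists (A `&` [set s' | `|G (s, x) - G (s', x)| <= e / 2], B) => /=.
    by split => //; exact: filterI.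
  move=> [s' y] [/= [As' h2] By]; have := AB (s', y) (conj As' By).
  rewrite /= /G/= in h2 * => h1.
  rewrite (_ : _ - _ = (g (dilate s x) - g (dilate s' y)) - (g (dilate s x) - g (dilate s' x))); last by ring.
  by apply: (le_trans (ler_normB _ _)); lra.
near=> y.
rewrite /radial_mean -RintegralB//; last 2 first.
- exact: continuous_unit_integrable (continuous_radial_integrand cg).
- exact: continuous_unit_integrable (continuous_radial_integrand cg).
apply: norm_unit_integral_le.
  apply: (continuous_unit_integrable (h := fun s => s ^+ k * g (dilate s x) - s ^+ k * g (dilate s y))).
  by apply: continuous_sub; exact: continuous_radial_integrand.
move=> s s01; rewrite -mulrBr normrM -[leRHS]mul1r.
apply: ler_pM => //; first exact: unit_power_le.
have : `[0, 1]%classic `<=` [set s : R | `|g (dilate s x) - g (dilate s y)| <= e] by near: y.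
by apply; have /andP[s0 s1] := s01; rewrite /= in_itv/= !ltW.
Unshelve. all: by end_near. Qed.

Lemma cext_radial_mean k f : cext f -> cext (radial_mean k f).
Proof.
move=> [g cg gf]; exists (radial_mean k g); first exact: continuous_radial_mean.
by move=> x px; apply: eq_radial_mean => //; exact: ltW.
Qed.

Let is_derive_from_line (f : 'rV[R]_3 -> R) x v d :
  is_derive (0 : R) 1 (fun t : R => f (x + t *: v)) d -> is_derive x v f d.
Proof.
move=> [df <-].
have E : (fun h : R => h^-1 *: (((fun s : R => f (x + s *: v)) \o shift 0) (h *: 1)
      - f (x + 0 *: v))) =
    (fun h : R => h^-1 *: ((f \o shift x) (h *: v) - f x)).
  apply/funext => h /=; congr (_ *: (f _ - f _)).
    by rewrite [h%:A]mulr1 addr0 addrC.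
  by rewrite scale0r addr0.
by split; [rewrite /derivable -E|rewrite /derive -E].
Qed.

(** The dilation acts on the two horizontal coordinates only, so each horizontal
    derivative of [f (dilate s x)] brings out a factor [s]. *)
Definition dilation_weight (i : 'I_3) : nat := i != 2.

Let slab_mem (a r t : R) (b : bool) : - r < t < r ->
  a - r <= a + t * b%:R <= a + r.
Proof. by move=> /andP[? ?]; case: b; rewrite ?mulr1 ?mulr0; apply/andP; split; lra. Qed.

Lemma is_derive_radial_mean k f i x : Ck 1 f -> pipe x ->
  is_derive x (delta_mx 0 i) (radial_mean k f)
    (radial_mean (k + dilation_weight i) (pd i f) x).
Proof.
move=> Cf px.
pose v : 'rV[R]_3 := delta_mx 0 i.
have [r r0 rP] := @near_parallelogram _ _ x v 0 _ (near_pipe px).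
have {}rP (t : R) : t \in `]- r, r[ -> pipe (x + t *: v).
  rewrite in_itv/= => /andP[t1 t2].
  have := rP t 0; rewrite scaler0 addr0 normr0; apply; last exact: ltW.
  by rewrite ler_norml !ltW.
have [M fM] := cext_bounded_slab (x 0 2 - r) (x 0 2 + r) (Ck_cext (Ck_pd i Cf)).
apply: is_derive_from_line.
pose F (t s : R) := s ^+ k * f (dilate s (x + t *: v)).
have dil s t : dilate s (x + t *: v) = dilate s x + (s ^+ dilation_weight i * t) *: v.
  rewrite /v; move: i {v rP fM F Cf} => i.
  by apply: eq_vec3; rewrite !mxE/=; move: i; apply: ord3P; rewrite /dilation_weight/= ?expr0 ?expr1; ring.
have dF t s : t \in `]- r, r[ -> 0 < s < 1 ->
    is_derive t 1 (F^~ s) (s ^+ (k + dilation_weight i) * pd i f (dilate s (x + t *: v))).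
  move=> tr s01; pose c := s ^+ dilation_weight i.
  have py : pipe (dilate s (x + t *: v)).
    by apply: pipe_dilate => //; apply: ltW; exact: rP.
  have d1 : is_derive (c * t) 1 (fun a : R => f (dilate s x + a *: v))
      (pd i f (dilate s (x + t *: v))).
    have := Ck_is_derive i Cf py; rewrite {1}dil; exact: is_derive_line.
  have d2 : is_derive t 1 (fun a : R => c * a) c.
    apply: is_derive_eq (is_derive_mul (is_derive_const c t 1) (is_derive_id t 1)) _.
    by rewrite mul0r add0r mulr1.
  have d3 := @is_derive1_comp _ (fun a : R => f (dilate s x + a *: v)) (fun a : R => c * a) t _ _ d1 d2.
  have d4 := is_derive_mul (is_derive_const (s ^+ k) t 1) d3.
  rewrite (_ : F^~ s = (fun a => s ^+ k * ((fun a : R => f (dilate s x + a *: v)) \o (fun a : R => c * a)) a)).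
    by apply: (is_derive_eq d4); rewrite mul0r add0r exprD -/c; ring.
  by apply/funext => a; rewrite /F dil.
have mB : measurable (`]0, 1[%classic : set R) by exact: measurable_itv.
have I0 : `]- r, r[%classic (0 : R) by rewrite /= in_itv/=; apply/andP; split; lra.
have iF (t : R) : `]- r, r[%classic t -> leb.-integrable (`]0, 1[%classic : set R) (EFin \o F t).
  by move=> /rP pt; apply: radial_mean_integrable; [exact: Ck_cext Cf|exact: ltW].
have dF1 (t s : R) : `]- r, r[%classic t -> `]0, 1[%classic s -> derivable (F^~ s) t 1.
  by move=> /= tr; rewrite in_itv/= => s01; have [] := dF t s tr s01.
have p1 (t s : R) : t \in `]- r, r[ -> 0 < s < 1 ->
    partial1of2 F t s = s ^+ (k + dilation_weight i) * pd i f (dilate s (x + t *: v)).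
  by move=> tr s01; rewrite partial1of2E; have [_ ->] := dF t s tr s01.
have M0 : forall s : R, 0 <= `|M| by [].
have iM : leb.-integrable (`]0, 1[%classic : set R) (EFin \o (fun=> `|M|)).
  by apply: continuous_unit_integrable; exact: continuous_const.
have G_ub (t s : R) : `]- r, r[%classic t -> `]0, 1[%classic s -> `|partial1of2 F t s| <= `|M|.
  move=> /= tr; rewrite in_itv/= => s01; rewrite p1// normrM -[leRHS]mul1r.
  apply: ler_pM => //; first exact: unit_power_le.
  apply: le_trans (ler_norm M); apply: fM.
    by apply: pipe_dilate => //; apply: ltW; exact: rP.
  by rewrite vec3E !mxE/=; apply: slab_mem; move: tr; rewrite in_itv.
split.
  exact: (@derivable_under_integral R _ _ leb F _ mB 0 _ _ I0 iF dF1 (fun=> `|M|) M0 iM G_ub).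
rewrite -derive1E.
rewrite (@differentiation_under_integral R _ _ leb F _ mB 0 _ _ I0 iF dF1 (fun=> `|M|) M0 iM G_ub).
apply: eq_Rintegral => s /set_mem; rewrite /= in_itv/= => s01.
by rewrite p1// scale0r addr0.
Qed.

Lemma Ck_radial_mean n k f : Ck n f -> Ck n (radial_mean k f).
Proof.
elim: n k f => [|n IH] k f Cf; first by split => //; exact: cext_radial_mean (Ck_cext Cf).
split; first exact: cext_radial_mean (Ck_cext Cf).
have C1 : Ck 1 f.
  by elim: n f Cf {IH} => // n IH f Cf; apply: IH; exact: CkW.
move=> i; split; first by move=> x px; have [] := is_derive_radial_mean k i C1 px.
apply: (@eq_Ck _ n (radial_mean (k + dilation_weight i) (pd i f))).
  by move=> x px; rewrite (pd_is_derive (is_derive_radial_mean k i C1 px)).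
exact: IH (Ck_pd i Cf).
Qed.

(** The integrand is the derivative of s^2 f(s x_h, x_3) with respect to s. *)
Lemma radial_mean_euler f x : Ck 1 f -> pipe x ->
  2 * radial_mean 1 f x + x 0 0 * radial_mean 2 (pd 0 f) x
    + x 0 1 * radial_mean 2 (pd 1 f) x = f x.
Proof.
move=> Cf px.
have [g cg gf] := Ck_cext Cf.
have [g0 cg0 gf0] := Ck_cext (Ck_pd 0 Cf); have [g1 cg1 gf1] := Ck_cext (Ck_pd 1 Cf).
have x1 : rad2 x <= 1 by exact: ltW.
rewrite -(@eq_radial_mean _ g f)// -(@eq_radial_mean _ g0 (pd 0 f))//.
rewrite -(@eq_radial_mean _ g1 (pd 1 f))// -gf//.
rewrite /radial_mean -!RintegralZl//; last 3 first.
- exact: continuous_unit_integrable (continuous_radial_integrand cg1).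
- exact: continuous_unit_integrable (continuous_radial_integrand cg0).
- exact: continuous_unit_integrable (continuous_radial_integrand cg).
have cc (c : R) k h : continuous h -> continuous (fun s => c * (s ^+ k * h (dilate s x))).
  by move=> ch; apply: continuous_mul; [exact: continuous_const|exact: continuous_radial_integrand].
pose h s := 2 * (s ^+ 1 * g (dilate s x)) + x 0 0 * (s ^+ 2 * g0 (dilate s x)).
pose h2 s := h s + x 0 1 * (s ^+ 2 * g1 (dilate s x)).
have ch : continuous h by apply: continuous_add; exact: cc.
have ch2 : continuous h2 by apply: continuous_add => //; exact: cc.
rewrite -RintegralD//; last 2 first.
- exact: continuous_unit_integrable (cc _ _ _ cg).
- exact: continuous_unit_integrable (cc _ _ _ cg0).
rewrite -RintegralD//; last 2 first.
- exact: (continuous_unit_integrable ch).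
- exact: continuous_unit_integrable (cc _ _ _ cg1).
rewrite -/(h2 _).
pose P s := s ^+ 2 * g (dilate s x).
have dil s : dilate s x = vec3 0 0 (x 0 2) + s *: vec3 (x 0 0) (x 0 1) 0.
  by apply: eq_vec3; rewrite !mxE/=; ring.
have dP s : 0 < s < 1 -> is_derive s 1 P (h2 s).
  move=> s01; have py := pipe_dilate s01 x1.
  have d1 : is_derive (dilate s x) (vec3 (x 0 0) (x 0 1) 0) g
      (x 0 0 * g0 (dilate s x) + x 0 1 * g1 (dilate s x)).
    rewrite gf0// gf1//; apply: near_eq_is_derive (is_derive_horizontal _ _ Cf py).
    by apply: filterS (near_pipe py) => y /gf.
  rewrite {1}dil in d1.
  have d2 := is_derive_mul (is_derive_exp 1 (is_derive_id s 1)) (is_derive_line d1).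
  rewrite (_ : P = (fun a => a ^+ 2 * g (vec3 0 0 (x 0 2) + a *: vec3 (x 0 0) (x 0 1) 0))).
    by apply: (is_derive_eq d2); rewrite /h2 /h -dil/=; ring.
  by apply/funext => a; rewrite /P dil.
have cP : continuous P by exact: continuous_radial_integrand.
have mh2 : measurable_fun (`]0, 1[%classic : set R) (EFin \o h2).
  by apply/measurable_EFinP; apply: measurable_funTS; exact: continuous_measurable_fun.
rewrite /Rintegral (@integral_itv_bndo_bndc _ _ _ (EFin \o h2)) ?(@integral_itv_obnd_cbnd _ _ _ (EFin \o h2))//.
- rewrite (@continuous_FTC2 _ h2 P 0 1 ltr01) ?subr0//.
  + rewrite /P expr1n mul1r expr0n mul0r -EFinD subr0; congr g.
    by apply: eq_vec3; rewrite !mxE/= ?mul1r.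
  + exact: continuous_subspaceT.
  + split.
    * by move=> t; rewrite in_itv/= => /dP[].
    * exact/cvg_at_right_filter/cP.
    * exact/cvg_at_left_filter/cP.
  + by move=> t; rewrite in_itv/= => /dP[_ <-]; rewrite derive1E.
- by apply/measurable_EFinP; apply: measurable_funTS; exact: continuous_measurable_fun.
Qed.

End RadialMeans.

(** * A Liouville theorem on the line *)

Section OneDimensionalLiouville.
Context {R : realType}.
Implicit Types (E d e q f : R -> R) (z : R).

Lemma derive_lower_bound f f' (a b c : R) : a <= b ->
  (forall z, is_derive z 1 f (f' z)) -> (forall z, z <= b -> c <= f' z) ->
  c * (b - a) <= f b - f a.
Proof.
move=> ab df cf.
have [|z zab ->] := @MVT_segment R f f' a b ab (fun z _ => df z).
  by apply: derivable_within_continuous => z _; have [] := df z.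
rewrite ler_wpM2r ?subr_ge0// cf//.
by move: zab; rewrite in_itv/= => /andP[].
Qed.

(** If E is positive at z0 it stays above E(z0) on the left, by monotonicity. With
    l = E(z0)/2, the bound for e makes d - (K/l) E grow at least at rate l there;
    as d is bounded, E tends to infinity backwards. Since q, hence e, is bounded,
    d' = E - e is eventually at least 1, which contradicts the bound on d. *)
Let energy_le0 E d e q (K M B : R) :
  (forall z, is_derive z 1 E (- q z)) ->
  (forall z, is_derive z 1 d (E z - e z)) ->
  (forall z, 0 <= q z <= B) -> (forall z, `|d z| <= M) -> 0 < K ->
  (forall z l : R, 0 < l -> `|e z| <= l + K / l * q z) ->
  forall z, E z <= 0.
Proof.
move=> dE dd q0 dM K0 eK z0; rewrite leNgt; apply/negP => E0.
pose l := E z0 / 2.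
have l0 : 0 < l by rewrite /l; lra.
have Emono a b : a <= b -> E b <= E a.
  move=> ab; have := @derive_lower_bound (fun z => - E z) (fun z => - - q z) a b 0 ab.
  rewrite mul0r => h; rewrite -lerN2 -subr_ge0; apply: h => z _.
  by rewrite opprK; have /andP[] := q0 z.
pose H z := d z + (- (K / l)) * E z.
have dH z : is_derive z 1 H (E z - e z + K / l * q z).
  have h := is_derive_add (dd z) (is_derive_mul (is_derive_const (- (K / l)) z 1) (dE z)).
  by apply: (is_derive_eq h); rewrite mul0r add0r mulrNN.
have eE z : - (l + K / l * q z) <= e z <= l + K / l * q z.
  by have := eK z l l0; rewrite ler_norml.
have Hgrow z : z <= z0 -> l * (z0 - z) <= H z0 - H z.
  move=> zz0; apply: (derive_lower_bound zz0 dH) => w wz0.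
  have /andP[_ ew] := eE w; have := Emono w z0 wz0; rewrite /l in ew *; lra.
pose T := 2 + K * B.
have Kl0 : 0 < K / l by rewrite divr_gt0.
pose s := (`|H z0| + M + K / l * `|T|) / l.
have M0 : 0 <= M by apply: le_trans (dM 0); exact: normr_ge0.
have s0 : 0 <= s.
  by apply: divr_ge0; [rewrite !addr_ge0// mulr_ge0// ltW|exact: ltW].
have ET : T <= E (z0 - s).
  have := Hgrow (z0 - s) ltac:(lra).
  rewrite opprB addrC subrK (_ : l * s = `|H z0| + M + K / l * `|T|); last first.
    by rewrite mulrC /s divfK// gt_eqF.
  have -> : H (z0 - s) = d (z0 - s) - K / l * E (z0 - s) by rewrite /H mulNr.
  move=> h.
  have := dM (z0 - s); rewrite ler_norml => /andP[d1 d2].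
  have := ler_norm (H z0) => h2; have hT := ler_norm T.
  have h3 : K / l * `|T| <= K / l * E (z0 - s) by lra.
  by apply: (le_trans hT); rewrite -(ler_pM2l Kl0).
have := @derive_lower_bound d _ (z0 - s - (2 * M + 1)) (z0 - s) 1 ltac:(lra) dd _.
have h1 w : w <= z0 - s -> 1 <= E w - e w.
  move=> ws; have := Emono w _ ws; have := eK w 1 ltr01.
  rewrite ler_norml => /andP[_]; rewrite divr1 => ew Ew.
  have /andP[_ qB] := q0 w.
  have : K * q w <= K * B by rewrite ler_pM2l.
  by rewrite /T in ET; lra.
move=> /(_ h1); have := dM (z0 - s); have := dM (z0 - s - (2 * M + 1)).
by rewrite !ler_norml => /andP[? ?] /andP[? ?]; lra.
Qed.

(** The hypotheses are invariant under the reflection z -> - z, which exchanges E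
    with - E; hence E vanishes identically. *)
Lemma dissipation_eq0 E d e q (K M B : R) :
  (forall z, is_derive z 1 E (- q z)) ->
  (forall z, is_derive z 1 d (E z - e z)) ->
  (forall z, 0 <= q z <= B) -> (forall z, `|d z| <= M) -> 0 < K ->
  (forall z l : R, 0 < l -> `|e z| <= l + K / l * q z) ->
  forall z, q z = 0.
Proof.
move=> dE dd q0 dM K0 eK z.
have Ele := energy_le0 dE dd q0 dM K0 eK.
have mirror f (w : R) df : is_derive (- w) 1 f df -> is_derive w 1 (fun t => f (- t)) (- df).
  move=> df'; have := @is_derive1_comp _ f -%R w _ _ df' (is_deriveNid w 1).
  by rewrite mulrN1.
have Ege w : 0 <= E w.
  have := @energy_le0 (fun t => - E (- t)) (fun t => d (- t)) (fun t => - e (- t))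
    (fun t => q (- t)) K M B _ _ _ _ K0 _ (- w).
  rewrite opprK oppr_le0; apply.
  - by move=> t; apply: (is_derive_eq (is_derive_opp (mirror _ _ _ (dE (- t))))); rewrite opprK.
  - by move=> t; apply: (is_derive_eq (mirror _ _ _ (dd (- t)))); ring.
  - by move=> t; exact: q0.
  - by move=> t; exact: dM.
  - by move=> t l l0; rewrite normrN; exact: eK.
have E0 : E = fun=> 0 by apply/funext => w; apply/eqP; rewrite eq_le Ele Ege.
have [_ +] := dE z; rewrite E0 => /eqP; rewrite derive_cst eq_sym oppr_eq0.
by move=> /eqP.
Qed.

End OneDimensionalLiouville.

(** Pointwise identities below are polynomial in the values of the fields and of
    their derivatives; replacing those values by variables prevents arithmetic
    tactics from unfolding the derivatives. *)
Ltac abstract_fields :=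
  repeat match goal with
  | |- context [@pd ?R ?i ?f ?x] => generalize (@pd R i f x); intro
  | |- context [@component ?R ?u ?i ?x] => generalize (@component R u i x); intro
  | |- context [@fun_of_matrix ?T ?m ?n ?x ?i ?j] =>
      generalize (@fun_of_matrix T m n x i j); intro
  end.

(** * The wall conditions *)

Section BoundaryValues.
Context {R : realType}.

(** The limit from the interior that defines a boundary value is computed by any
    continuous extension. *)
Lemma bdry_valueE m n (F G : 'rV[R]_3 -> 'M[R]_(m.+1, n.+1)) x :
  (forall i j, continuous (fun y => G y i j)) ->
  (forall y, pipe y -> F y = G y) -> rad2 x <= 1 ->
  bdry_value (@pipe R) F x = G x.
Proof.
move=> cG FG x1; rewrite /bdry_value.
have pf : ProperFilter (within (@pipe R) (nbhs x)).
  exact: within_nbhs_proper (closed_pipe_closure x1).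
apply: cvg_lim; first exact: norm_hausdorff.
apply: cvg_mx => i j.
have : (fun y => F y i j) @ within (@pipe R) (nbhs x) --> G x i j.
  apply: (@cvg_trans _ ((fun y => G y i j) @ within (@pipe R) (nbhs x))).
    apply: near_eq_cvg; rewrite near_withinE.
    by near=> y => py; rewrite FG.
  exact: (cvg_trans (cvg_app _ (@cvg_within _ _ _ _)) (cG i j x)).
by [].
Unshelve. all: by end_near. Qed.

End BoundaryValues.

Section Flow.
Context {R : realType} (u : 'rV[R]_3 -> 'rV[R]_3) (p : 'rV[R]_3 -> R).
Context (sol : smooth_slip_NS_solution u p).
Implicit Types (x : 'rV[R]_3) (i j : 'I_3).

Local Notation U := (component u).

Lemma Ck_velocity n i : Ck n (U i).
Proof. by apply: smooth_Ck; exact: velocity_smooth sol i. Qed.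

Lemma Ck_pressure n : Ck n p.
Proof. by apply: smooth_Ck; exact: pressure_smooth sol. Qed.

Lemma divergence_free x : pipe x -> pd 0 (U 0) x + pd 1 (U 1) x + pd 2 (U 2) x = 0.
Proof. by move=> px; have := incompressible sol px; rewrite /divergence sum3E. Qed.

Lemma pressure_gradient j x : pipe x ->
  pd j p x = pd 0 (pd 0 (U j)) x + pd 1 (pd 1 (U j)) x + pd 2 (pd 2 (U j)) x
    - (U 0 x * pd 0 (U j) x + U 1 x * pd 1 (U j) x + U 2 x * pd 2 (U j) x).
Proof.
move=> px; have /rowP/(_ j) := momentum sol px.
rewrite !mxE !sum3E /component; abstract_fields; move=> h; lra.
Qed.

Lemma normal_velocity_zero : lateral_zero (fun x => x 0 0 * U 0 x + x 0 1 * U 1 x).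
Proof.
have ext i := cid2 (Ck_cext (Ck_velocity 0 i)).
pose G (x : 'rV[R]_3) : 'rV[R]_3 := \row_i (s2val (ext i)) x.
exists (fun x => x 0 0 * G x 0 0 + x 0 1 * G x 0 1).
  have cG i : continuous (fun x => G x 0 i).
    by under eq_fun do rewrite mxE; exact: (s2valP (ext i)).
  by apply: continuous_add; apply: continuous_mul => //; exact: coord_continuous.
have GU i x : pipe x -> G x 0 i = U i x.
  by move=> px; rewrite mxE; exact: (s2valP' (ext i)).
split => x bx; first by rewrite !GU.
have := impermeable sol bx; rewrite (@bdry_valueE _ _ _ u G).
- by rewrite /dot sum3E /pipe_normal !vec3E mulr0 addr0 ![_ * x 0 _]mulrC.
- by move=> i j; rewrite ord1; under eq_fun do rewrite mxE; exact: (s2valP (ext j)).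
- by move=> y py; apply/rowP => i; rewrite GU.
- by rewrite /rad2; move: bx; rewrite /pipe_boundary/= => ->.
Qed.

(** The i-th component of twice the strain applied to the horizontal position
    vector, which is the normal on the wall: the viscous stress there. *)
Definition traction i x : R :=
  x 0 0 * (pd i (U 0) x + pd 0 (U i) x) + x 0 1 * (pd i (U 1) x + pd 1 (U i) x).

(** The slip condition says that the stress on the wall is normal to it. *)
Lemma tangential_traction_zero i :
  lateral_zero (fun x => traction i x -
    (traction 0 x * x 0 0 + traction 1 x * x 0 1) * pipe_normal x 0 i).
Proof.
have extd a b := cid2 (Ck_cext (Ck_pd b (Ck_velocity 1 a))).
pose H a b := s2val (extd a b).
have cH a b : continuous (H a b) by exact: (s2valP (extd a b)).
have HU a b x : pipe x -> H a b x = pd b (U a) x by exact: (s2valP' (extd a b)).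
pose S (x : 'rV[R]_3) : 'M[R]_3 := \matrix_(a, b) (2^-1 * (H a b x + H b a x)).
pose tr a (x : 'rV[R]_3) := x 0 0 * (H 0 a x + H a 0 x) + x 0 1 * (H 1 a x + H a 1 x).
have cn a : continuous (fun x : 'rV[R]_3 => pipe_normal x 0 a).
  move: a; apply: ord3P; under eq_fun do rewrite vec3E;
    [exact: coord_continuous|exact: coord_continuous|exact: continuous_const].
have ctr a : continuous (tr a).
  by apply: continuous_add; apply: continuous_mul; try exact: coord_continuous;
    exact: continuous_add.
exists (fun x => tr i x - (tr 0 x * x 0 0 + tr 1 x * x 0 1) * pipe_normal x 0 i).
  apply: continuous_sub => //; apply: continuous_mul => //.
  by apply: continuous_add; apply: continuous_mul => //; exact: coord_continuous.
have trE a x : pipe x -> tr a x = traction a x.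
  by move=> px; rewrite /tr /traction !HU.
split => x bx; first by rewrite !trE.
have := slip sol bx; rewrite (@bdry_valueE _ _ _ (strain u) S).
- have Sn a : mulMv (S x) (pipe_normal x) 0 a = 2^-1 * tr a x.
    rewrite /mulMv mxE mxE sum3E /pipe_normal /tr.
    rewrite ![_^T _ _]mxE !vec3E ![S x _ _]mxE; abstract_fields.
    by move: (H a 0 x) (H a 1 x) (H 0 a x) (H 1 a x) => b c d e; ring.
  move=> /rowP/(_ i); rewrite /tangential /dot sum3E.
  rewrite [LHS]mxE [X in _ + X = _]mxE [X in _ - X = _]mxE [RHS]mxE !Sn.
  have -> : pipe_normal x 0 0 = x 0 0 by rewrite vec3E.
  have -> : pipe_normal x 0 1 = x 0 1 by rewrite vec3E.
  have -> : pipe_normal x 0 2 = 0 by rewrite vec3E.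
  move: (tr i x) (tr 0 x) (tr 1 x) (tr 2 x) (pipe_normal x 0 i) => a b c d n.
  by abstract_fields; move=> h; rewrite -(mulr0 2) -h; field.
- move=> a b; under eq_fun do rewrite mxE.
  by apply: continuous_mul; [exact: continuous_const|exact: continuous_add].
- by move=> y py; apply/matrixP => a b; rewrite !mxE !HU.
- by rewrite /rad2; move: bx; rewrite /pipe_boundary/= => ->.
Qed.

(** * The energy flux through a cross-section *)

Ltac solve_Ck :=
  match goal with
  | |- Ck _ (component _ _) => exact: Ck_velocity
  | |- Ck _ (fun x => component _ _ x) => exact: Ck_velocity
  | |- Ck _ (pd _ _) => apply: Ck_pd; solve_Ck
  | |- Ck _ (fun x => pd _ _ x) => apply: Ck_pd; solve_Ck
  | |- Ck _ (fun x => _ + _) => apply: CkD; solve_Ck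
  | |- Ck _ (fun x => _ * _) => apply: CkM; solve_Ck
  | |- Ck _ (fun x => - _) => apply: CkN; solve_Ck
  | |- Ck _ (fun x => fun_of_matrix x _ _) => exact: Ck_coord
  | |- _ => first [exact: Ck_cst | exact: Ck_pressure | eassumption]
  end.

(** Differentiates sums and products structurally; a leaf is a coordinate, a
    constant or a field whose regularity [solve_Ck] knows. The proof [px] places
    the point inside the cylinder. *)
Ltac derive_field px :=
  match goal with
  | |- is_derive _ _ (fun y => _ + _) _ =>
      notypeclasses refine (is_derive_add _ _); derive_field px
  | |- is_derive _ _ (fun y => _ * _) _ =>
      notypeclasses refine (is_derive_mul _ _); derive_field px
  | |- is_derive _ _ (fun y => - _) _ =>
      notypeclasses refine (is_derive_opp _); derive_field px
  | |- is_derive _ _ (fun y => fun_of_matrix y _ _) _ =>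
      exact: is_derive_coord
  | |- _ =>
      first [notypeclasses refine (is_derive_const _ _ _)
            |notypeclasses refine (@Ck_is_derive _ 0 _ _ _ _ px); solve_Ck]
  end.

Ltac compute_pd px :=
  repeat match goal with
  | |- context [@pd ?R ?i ?F ?x] =>
      lazymatch F with
      | component _ _ => fail
      | pd _ _ => fail
      | _ => assert_fails (is_var F)
      end;
      let d := fresh "d" in
      evar (d : Real.sort R);
      let H := fresh "H" in
      assert (H : is_derive x (delta_mx 0 i) F d) by (unfold d; derive_field px);
      apply pd_is_derive in H; rewrite H; unfold d; clear H d
  end; cbv beta.

Lemma divergence_free_pd i x : pipe x ->
  pd i (pd 0 (U 0)) x + pd i (pd 1 (U 1)) x + pd i (pd 2 (U 2)) x = 0.
Proof.
move=> px.
rewrite -(@pdD _ 0 (pd 0 (U 0)) (pd 1 (U 1)) i x); [|solve_Ck|solve_Ck|assumption].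
rewrite -(@pdD _ 0 (fun y => pd 0 (U 0) y + pd 1 (U 1) y)); [|solve_Ck|solve_Ck|assumption].
rewrite -(pd_cst 0 i x); apply: eq_pd px => y py; exact: divergence_free.
Qed.

Lemma velocity_pd_comm i j k x : pipe x ->
  pd i (pd j (U k)) x = pd j (pd i (U k)) x.
Proof. by move=> px; apply: pd_comm px; exact: Ck_velocity. Qed.

Lemma pd_axial_velocity x : pipe x ->
  pd 2 (U 2) x = - (pd 0 (U 0) x + pd 1 (U 1) x).
Proof. by move=> /divergence_free; abstract_fields; move=> h; lra. Qed.

Lemma pd_pd_axial_velocity i x : pipe x ->
  pd i (pd 2 (U 2)) x = - (pd i (pd 0 (U 0)) x + pd i (pd 1 (U 1)) x).
Proof. by move=> /(divergence_free_pd i); abstract_fields; move=> h; lra. Qed.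

Definition head x : R :=
  2^-1 * (U 0 x * U 0 x + U 1 x * U 1 x + U 2 x * U 2 x) + p x.

(** The power of the viscous stress through a surface orthogonal to the i-th
    axis. *)
Definition viscous_power i x : R :=
  U 0 x * (pd i (U 0) x + pd 0 (U i) x) + U 1 x * (pd i (U 1) x + pd 1 (U i) x)
  + U 2 x * (pd i (U 2) x + pd 2 (U i) x).

(** To the energy flux of the Navier-Stokes equations is added the field with
    horizontal part - 2 u_h d_3 u_3 and axial part 2 u_h . grad_h u_3. Its
    divergence is 2 (d_3 u_3)^2 + 2 d_3 u_h . grad_h u_3, which removes the
    indefinite product from the dissipation, and it is tangential to the wall
    like the velocity. *)
Definition energy_flux0 x : R :=
  U 0 x * head x - viscous_power 0 x - 2 * (U 0 x * pd 2 (U 2) x).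
Definition energy_flux1 x : R :=
  U 1 x * head x - viscous_power 1 x - 2 * (U 1 x * pd 2 (U 2) x).
Definition energy_flux2 x : R :=
  U 2 x * head x - viscous_power 2 x
  + 2 * (U 0 x * pd 0 (U 2) x + U 1 x * pd 1 (U 2) x).

(** The squares of the horizontal strain, of the axial derivative of u_h and of the
    horizontal gradient of u_3: unlike twice the squared strain, it controls
    these derivatives separately. *)
Definition dissipation x : R :=
  2 * pd 0 (U 0) x ^+ 2 + 2 * pd 1 (U 1) x ^+ 2
  + (pd 0 (U 1) x + pd 1 (U 0) x) ^+ 2
  + pd 2 (U 0) x ^+ 2 + pd 2 (U 1) x ^+ 2
  + pd 0 (U 2) x ^+ 2 + pd 1 (U 2) x ^+ 2.

(** Brings into the goal the relations between first and second derivatives of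
    the velocity that incompressibility and symmetry give at x, abstracts the
    derivatives into variables, and eliminates the redundant ones. *)
Ltac eliminate_derivatives px :=
  generalize (pd_axial_velocity px) (pd_pd_axial_velocity 0 px)
    (pd_pd_axial_velocity 1 px) (pd_pd_axial_velocity 2 px)
    (velocity_pd_comm 1 0 0 px) (velocity_pd_comm 1 0 1 px) (velocity_pd_comm 1 0 2 px)
    (velocity_pd_comm 2 0 0 px) (velocity_pd_comm 2 0 1 px) (velocity_pd_comm 2 0 2 px)
    (velocity_pd_comm 2 1 0 px) (velocity_pd_comm 2 1 1 px) (velocity_pd_comm 2 1 2 px);
  abstract_fields; intros; subst.

Lemma energy_identity x : pipe x ->
  pd 0 energy_flux0 x + pd 1 energy_flux1 x + pd 2 energy_flux2 x = - dissipation x.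
Proof.
move=> px; rewrite /energy_flux0 /energy_flux1 /energy_flux2 /head /viscous_power.
compute_pd px.
rewrite /dissipation; move: (pressure_gradient 0 px) (pressure_gradient 1 px) (pressure_gradient 2 px).
eliminate_derivatives px.
by field.
Qed.

(** Conservation law in integrated form: without a flux through the wall, the flux
    through a section changes by the source in that section. *)
Lemma is_derive_section_flux (f0 f1 f2 h : 'rV[R]_3 -> R) (z : R) :
  Ck 1 f0 -> Ck 1 f1 -> Ck 1 f2 -> cext h ->
  lateral_zero (fun x => x 0 0 * f0 x + x 0 1 * f1 x) ->
  (forall x, pipe x -> pd 0 f0 x + pd 1 f1 x + pd 2 f2 x = h x) ->
  is_derive z 1 (sint f2) (sint h z).
Proof.
move=> C0 C1 C2 ch lz dh; apply: (is_derive_eq (is_derive_sint z C2)).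
have c01 : cext (fun x => pd 0 f0 x + pd 1 f1 x).
  by apply: cextD; apply: Ck_cext; [exact: Ck_pd C0|exact: Ck_pd C1].
have := sint_divergence z C0 C1 lz => d0.
rewrite -[LHS]add0r -d0 -sintD//; last exact: Ck_cext (Ck_pd 2 C2).
by apply: eq_sint.
Qed.

Let normal_stress x := traction 0 x * x 0 0 + traction 1 x * x 0 1.

Let Ck_traction n i : Ck n (traction i).
Proof. by rewrite /traction; solve_Ck. Qed.

Let Ck_normal_stress n : Ck n normal_stress.
Proof.
by rewrite /normal_stress; apply: CkD; apply: CkM; by [exact: Ck_traction|exact: Ck_coord].
Qed.

Let Ck_head n : Ck n head.
Proof. by rewrite /head; solve_Ck. Qed.

Lemma Ck_energy_flux n : [/\ Ck n energy_flux0, Ck n energy_flux1 & Ck n energy_flux2].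
Proof. by split; rewrite /energy_flux0 /energy_flux1 /energy_flux2 /head /viscous_power; solve_Ck. Qed.

Lemma Ck_dissipation n : Ck n dissipation.
Proof.
rewrite /dissipation; apply: (@eq_Ck _ n (fun x =>
  2 * (pd 0 (U 0) x * pd 0 (U 0) x) + 2 * (pd 1 (U 1) x * pd 1 (U 1) x)
  + (pd 0 (U 1) x + pd 1 (U 0) x) * (pd 0 (U 1) x + pd 1 (U 0) x)
  + pd 2 (U 0) x * pd 2 (U 0) x + pd 2 (U 1) x * pd 2 (U 1) x
  + pd 0 (U 2) x * pd 0 (U 2) x + pd 1 (U 2) x * pd 1 (U 2) x)); last by solve_Ck.
by move=> x _; abstract_fields; ring.
Qed.

(** No energy leaves through the wall: the stress there is normal and the
    velocity tangential. *)
Lemma energy_flux_lateral :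
  lateral_zero (fun x => x 0 0 * energy_flux0 x + x 0 1 * energy_flux1 x).
Proof.
have T i : lateral_zero (fun x => (- U i x) *
    (traction i x - normal_stress x * pipe_normal x 0 i)).
  apply: lateral_zeroM (tangential_traction_zero i).
  exact: (Ck_cext (CkN (Ck_velocity 0 i))).
have N : lateral_zero (fun x => (head x + - (2 * pd 2 (U 2) x) + - normal_stress x) *
    (x 0 0 * U 0 x + x 0 1 * U 1 x)).
  apply: lateral_zeroM normal_velocity_zero; apply: (@Ck_cext _ 0).
  apply: CkD; last by apply: CkN.
  by apply: CkD => //; solve_Ck.
apply: eq_lateral_zero (lateral_zeroD N (lateral_zeroD (T 0) (lateral_zeroD (T 1) (T 2)))).
move=> x _; rewrite /energy_flux0 /energy_flux1 /viscous_power /pipe_normal !vec3E.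
rewrite /traction; move: (head x) (normal_stress x) => h s.
by abstract_fields; ring.
Qed.

Lemma is_derive_energy (z : R) :
  is_derive z 1 (sint energy_flux2) (- sint dissipation z).
Proof.
have [C0 C1 C2] := Ck_energy_flux 1.
have cQ := Ck_cext (Ck_dissipation 0).
rewrite -sintN//.
apply: is_derive_section_flux C0 C1 C2 _ energy_flux_lateral energy_identity.
exact: (Ck_cext (CkN (Ck_dissipation 0))).
Qed.

(** The flux of axial momentum apart from the pressure. *)
Definition momentum_flux i x : R := U i x * U 2 x - (pd i (U 2) x + pd 2 (U i) x).

Lemma is_derive_momentum (z : R) :
  is_derive z 1 (sint (fun x => momentum_flux 2 x + p x)) 0.
Proof.
have Cm n i : Ck n (momentum_flux i) by rewrite /momentum_flux; solve_Ck.
rewrite -(_ : sint (fun=> 0) z = 0); last by rewrite sint_cst mul0r.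
apply: (@is_derive_section_flux (momentum_flux 0) (momentum_flux 1)).
- exact: Cm.
- exact: Cm.
- by apply: CkD; [exact: Cm|exact: Ck_pressure].
- exact: (Ck_cext (Ck_cst 0 0)).
- have T : lateral_zero (fun x => (-1) * (traction 2 x - normal_stress x * pipe_normal x 0 2)).
    by apply: lateral_zeroM (tangential_traction_zero 2); exact: (Ck_cext (Ck_cst 0 (-1))).
  have N := lateral_zeroM (Ck_cext (Ck_velocity 0 2)) normal_velocity_zero.
  apply: eq_lateral_zero (lateral_zeroD N T) => x _.
  rewrite /momentum_flux /pipe_normal !vec3E /traction.
  by move: (normal_stress x) => s; abstract_fields; ring.
- move=> x px; rewrite /momentum_flux; compute_pd px.
  move: (pressure_gradient 2 px); eliminate_derivatives px.
  by ring.
Qed.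

Lemma is_derive_mass (z : R) : is_derive z 1 (sint (U 2)) 0.
Proof.
rewrite -(_ : sint (fun=> 0) z = 0); last by rewrite sint_cst mul0r.
apply: (@is_derive_section_flux (U 0) (U 1)); try exact: Ck_velocity.
- exact: (Ck_cext (Ck_cst 0 0)).
- exact: normal_velocity_zero.
- exact: divergence_free.
Qed.

(** * Rigidity of flows without dissipation *)

(** The cylinder contains the path to the origin made of three segments parallel
    to the axes. *)
Lemma zero_gradient_constant (f : 'rV[R]_3 -> R) : Ck 1 f ->
  (forall i x, pipe x -> pd i f x = 0) -> forall x, pipe x -> f x = f 0.
Proof.
move=> Cf f0 x px.
have step y i (h : R) : (forall s : R, 0 <= s <= 1 -> pipe (y + (s * h) *: delta_mx 0 i)) ->
    f (y + h *: delta_mx 0 i) = f y.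
  move=> py; have [s s01|s s01 e] := @MVT_line R _ f (pd i f) y (delta_mx 0 i) h.
    exact: (Ck_is_derive i Cf (py s s01)).
  by apply/eqP; rewrite -subr_eq0 e f0 ?mulr0//; exact: py.
have px2 : x 0 0 ^+ 2 + x 0 1 ^+ 2 < 1 by exact: px.
have h0 := sqr_ge0 (x 0 0); have h1 := sqr_ge0 (x 0 1).
have sq (s a : R) : 0 <= s <= 1 -> (s * a) ^+ 2 <= a ^+ 2.
  move=> /andP[s0 s1]; rewrite exprMn ler_piMl ?sqr_ge0//.
  by rewrite exprn_ile1.
transitivity (f (vec3 0 (x 0 1) (x 0 2))).
  rewrite -(step (vec3 0 (x 0 1) (x 0 2)) 0 (x 0 0)).
    by congr f; apply: eq_vec3; rewrite !mxE/= ?mulr1 ?mulr0 ?addr0 ?add0r.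
  move=> s s01; rewrite /pipe/= !mxE/= ?mulr1 ?mulr0 ?add0r ?addr0.
  by have := sq s (x 0 0) s01; lra.
transitivity (f (vec3 0 0 (x 0 2))).
  rewrite -(step (vec3 0 0 (x 0 2)) 1 (x 0 1)).
    by congr f; apply: eq_vec3; rewrite !mxE/= ?mulr1 ?mulr0 ?addr0 ?add0r.
  move=> s s01; rewrite /pipe/= !mxE/= ?mulr1 ?mulr0 ?add0r ?addr0 ?expr0n/= ?add0r.
  by have := sq s (x 0 1) s01; lra.
rewrite -(step 0 2 (x 0 2)).
  by congr f; apply: eq_vec3; rewrite !mxE/= ?mulr1 ?mulr0 ?addr0 ?add0r.
by move=> s s01; rewrite /pipe/= !mxE/= ?mulr0 ?addr0 ?expr0n/= ?addr0.
Qed.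

Lemma pd_eq0 (f : 'rV[R]_3 -> R) (c : R) i x : (forall y, pipe y -> f y = c) ->
  pipe x -> pd i f x = 0.
Proof. by move=> fc px; rewrite (eq_pd i fc px) pd_cst. Qed.

Section NoDissipation.
Hypothesis Q0 : forall x, pipe x -> dissipation x = 0.

Lemma strain_free x : pipe x ->
  [/\ pd 0 (U 0) x = 0, pd 1 (U 1) x = 0 & pd 0 (U 1) x + pd 1 (U 0) x = 0] /\
  [/\ pd 2 (U 0) x = 0, pd 2 (U 1) x = 0, pd 0 (U 2) x = 0 & pd 1 (U 2) x = 0].
Proof.
move=> px; have := Q0 px; rewrite /dissipation.
move: (pd 0 (U 1) x + pd 1 (U 0) x) => w; abstract_fields => Q.
have sq0 (a : R) : a ^+ 2 <= 0 -> a = 0.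
  by move=> a0; apply/eqP; rewrite -sqrf_eq0 eq_le a0 sqr_ge0.
have w0 := sqr_ge0 w.
repeat match goal with
| a : Real.sort R |- _ =>
    lazymatch goal with
    | _ : is_true (0 <= a ^+ 2) |- _ => fail
    | _ => have := sqr_ge0 a; intro
    end
end.
by split; split; apply: sq0; lra.
Qed.

(** As for the rotation rate of an infinitesimal rigid motion: each second
    derivative reduces, by symmetry, to the derivative of a strain component. *)
Let rotation_rate_constant i x : pipe x -> pd i (pd 0 (U 1)) x = 0.
Proof.
move=> px; move: i; apply: ord3P.
- transitivity (pd 0 (fun y => - pd 1 (U 0) y) x).
    apply: eq_pd px => y /strain_free[[_ _ +] _].
    by abstract_fields => h; lra.
  compute_pd px; rewrite (velocity_pd_comm 0 1 0 px) (@pd_eq0 _ 0) ?oppr0//.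
  by move=> y /strain_free[[]].
- rewrite (velocity_pd_comm 1 0 1 px) (@pd_eq0 _ 0)//.
  by move=> y /strain_free[[]].
- rewrite (velocity_pd_comm 2 0 1 px) (@pd_eq0 _ 0)//.
  by move=> y /strain_free[_ []].
Qed.

(** Without dissipation the motion is rigid; tangency to the wall leaves only
    rotation about the axis and translation along it, and the momentum equation
    then gives the centripetal pressure. *)
Theorem rigid_motion : exists C1 C2 : R,
  (forall x, pipe x ->
    [/\ U 0 x = - (C1 * x 0 1), U 1 x = C1 * x 0 0 & U 2 x = C2]) /\
  exists c : R, forall x, pipe x ->
    p x = C1 ^+ 2 * (x 0 0 ^+ 2 + x 0 1 ^+ 2) / 2 + c.
Proof.
have [C w1] : exists C, forall x, pipe x -> pd 0 (U 1) x = C.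
  exists (pd 0 (U 1) 0); apply: zero_gradient_constant => [|i y]; first by solve_Ck.
  exact: rotation_rate_constant.
have w0 x : pipe x -> pd 1 (U 0) x = - C.
  move=> px; have [[_ _ +] _] := strain_free px.
  by rewrite w1//; abstract_fields => h; lra.
pose v0 x := U 0 x + C * x 0 1; pose v1 x := U 1 x + (- C) * x 0 0.
have cv0 : Ck 1 v0 by rewrite /v0; solve_Ck.
have cv1 : Ck 1 v1 by rewrite /v1; solve_Ck.
have k0 x : pipe x -> v0 x = v0 0.
  apply: zero_gradient_constant => // i y py; rewrite /v0; compute_pd py.
  have [[e0 _ _] [e2 _ _ _]] := strain_free py.
  by move: i; apply: ord3P; rewrite ?e0 ?e2 ?(w0 _ py)/=; ring.
have k1 x : pipe x -> v1 x = v1 0.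
  apply: zero_gradient_constant => // i y py; rewrite /v1; compute_pd py.
  have [[_ e1 _] [_ e2 _ _]] := strain_free py.
  by move: i; apply: ord3P; rewrite ?e1 ?e2 ?(w1 _ py)/=; ring.
have k2 x : pipe x -> U 2 x = U 2 0.
  apply: zero_gradient_constant; first by solve_Ck.
  move=> i y py; have [[e0 e1 _] [_ _ e2 e3]] := strain_free py.
  by move: i; apply: ord3P => //; rewrite (pd_axial_velocity py) e0 e1 addr0 oppr0.
move: (v0 0) (v1 0) k0 k1 => a b k0 k1.
(* tangency to the wall excludes a horizontal translation *)
have [k ck [kh kb]] := normal_velocity_zero.
have ab x : rad2 x = 1 -> x 0 0 * a + x 0 1 * b = 0.
  move=> x1; rewrite -(kb x x1).
  apply: (@eq_on_closure _ (fun x => x 0 0 * a + x 0 1 * b)) => //.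
  - by apply: continuous_add; apply: continuous_mul; by [exact: coord_continuous|exact: continuous_const].
  - move=> y py; rewrite kh// -(k0 y py) -(k1 y py) /v0 /v1.
    by abstract_fields; ring.
  - by rewrite x1.
have a0 : a = 0.
  have := ab (vec3 1 0 0); rewrite /rad2 !vec3E expr0n expr1n addr0 => /(_ erefl).
  by rewrite mul1r mul0r addr0.
have b0 : b = 0.
  have := ab (vec3 0 1 0); rewrite /rad2 !vec3E expr0n expr1n add0r => /(_ erefl).
  by rewrite mul1r mul0r add0r.
have u0 x : pipe x -> U 0 x = - (C * x 0 1).
  by move=> px; have := k0 x px; rewrite a0 /v0 => /eqP; rewrite addr_eq0 => /eqP.
have u1 x : pipe x -> U 1 x = C * x 0 0.
  by move=> px; have := k1 x px; rewrite b0 /v1 mulNr => /eqP; rewrite subr_eq0 => /eqP.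
exists C, (U 2 0); split; first by move=> x px; rewrite u0// u1// k2.
pose r x := p x + (- (C ^+ 2 / 2)) * (x 0 0 * x 0 0 + x 0 1 * x 0 1).
have cr : Ck 1 r by rewrite /r; apply: CkD; [exact: Ck_pressure|solve_Ck].
have second i j l x : (exists d, forall y, pipe y -> pd j (U l) y = d) -> pipe x ->
    pd i (pd j (U l)) x = 0 by move=> [d hd] px; exact: (pd_eq0 i hd px).
have first (j l : 'I_3) : exists d, forall y, pipe y -> pd j (U l) y = d.
  move: j l; apply: ord3P; apply: ord3P.
  - by exists 0 => y /strain_free[[]].
  - by exists C.
  - by exists 0 => y /strain_free[_ []].
  - by exists (- C).
  - by exists 0 => y /strain_free[[]].
  - by exists 0 => y /strain_free[_ []].
  - by exists 0 => y /strain_free[_ []].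
  - by exists 0 => y /strain_free[_ []].
  - exists 0 => y py; have [[e0 e1 _] _] := strain_free py.
    by rewrite (pd_axial_velocity py) e0 e1 addr0 oppr0.
have kr x : pipe x -> r x = r 0.
  apply: zero_gradient_constant => // i y py; rewrite /r; compute_pd py.
  rewrite (pressure_gradient i py) !second//.
  have [[e0 e1 _] [e2 e3 e4 e5]] := strain_free py.
  have e6 : pd 2 (U 2) y = 0 by rewrite (pd_axial_velocity py) e0 e1 addr0 oppr0.
  move: i; apply: ord3P; rewrite ?e0 ?e1 ?e2 ?e3 ?e4 ?e5 ?e6 ?w0 ?w1// ?u0 ?u1//=;
    by field.
exists (r 0) => x px; rewrite -(kr x px) /r.
by abstract_fields; field.
Qed.

End NoDissipation.

Lemma dissipation_ge0 x : 0 <= dissipation x.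
Proof.
by rewrite /dissipation; repeat apply: addr_ge0; rewrite ?sqr_ge0// mulr_ge0 ?sqr_ge0.
Qed.

Lemma section_dissipation_eq0 : (forall z, sint dissipation z = 0) ->
  forall x, pipe x -> dissipation x = 0.
Proof.
move=> Q0; apply: sint_eq0 => //; first exact: (Ck_cext (Ck_dissipation 0)).
by move=> x _; exact: dissipation_ge0.
Qed.

(** * Flows periodic along the axis *)

Section AxialTranslation.
Variable L : R.
Local Notation shift_axis x := (x + L *: e_z R).

Lemma pipe_shift x : pipe x -> pipe (shift_axis x).
Proof. by rewrite /pipe/= !mxE/= !mulr0 !addr0. Qed.

Lemma pd_shift (f : 'rV[R]_3 -> R) i x : Ck 1 f -> pipe x ->
  pd i (fun y => f (shift_axis y)) x = pd i f (shift_axis x).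
Proof.
move=> Cf px; apply: pd_is_derive; apply: is_derive_translate.
exact: (Ck_is_derive i Cf (pipe_shift px)).
Qed.

Lemma cext_shift (f : 'rV[R]_3 -> R) : cext f -> cext (fun x => f (shift_axis x)).
Proof.
move=> [g cg gf]; exists (fun x => g (shift_axis x)).
  move=> x; apply: (@continuous_comp _ _ _ (fun x => shift_axis x) g); last exact: cg.
  by apply: (@cvgD _ _ _ (nbhs x) _ id (cst (L *: e_z R)) x (L *: e_z R)); [exact: cvg_id|exact: cvg_cst].
by move=> x /pipe_shift px; rewrite gf.
Qed.

Lemma Ck_shift n (f : 'rV[R]_3 -> R) : Ck n f -> Ck n (fun x => f (shift_axis x)).
Proof.
elim: n f => [|n IH] f Cf; first by split => //; exact: cext_shift (Ck_cext Cf).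
split; first exact: cext_shift (Ck_cext Cf).
move=> i; split.
  move=> x px.
  by have [] := is_derive_translate (Ck_is_derive i Cf (pipe_shift px)).
apply: (@eq_Ck _ n (fun x => pd i f (shift_axis x))); last exact: IH (Ck_pd i Cf).
move=> x px; apply/esym/pd_is_derive; apply: is_derive_translate.
exact: (Ck_is_derive i Cf (pipe_shift px)).
Qed.

Lemma sint_shift (f : 'rV[R]_3 -> R) z : sint f (z + L) = sint (fun x => f (shift_axis x)) z.
Proof.
apply: eq_dint => y _; congr f.
by apply: eq_vec3; rewrite !mxE/= ?mulr0 ?mulr1 ?addr0.
Qed.

Definition periodic (f : 'rV[R]_3 -> R) := forall x, pipe x -> f (shift_axis x) = f x.

Lemma periodic_pd i (f : 'rV[R]_3 -> R) : Ck 1 f -> periodic f -> periodic (pd i f).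
Proof.
by move=> Cf pf x px; rewrite -pd_shift//; exact: eq_pd.
Qed.

Hypothesis periodic_velocity : forall i, periodic (U i).
Hypothesis L_gt0 : 0 < L.

Let periodic_grad i j : periodic (pd i (U j)).
Proof. by apply: periodic_pd (periodic_velocity j); exact: Ck_velocity. Qed.

(** The pressure gradient is periodic, so the pressure grows linearly along the
    axis.  Balance of axial momentum between two sections one period apart
    forbids such a growth, because the wall exerts no axial traction. *)
Lemma periodic_pressure : periodic p.
Proof.
have Cp := Ck_pressure 1.
pose jump x := p (shift_axis x) + - p x.
have Cj : Ck 1 jump by apply: CkD; [exact: Ck_shift|exact: CkN].
have jumpE x : pipe x -> p (shift_axis x) = p x + jump 0.
  move=> px; rewrite -(@zero_gradient_constant jump Cj _ x px).
    by rewrite /jump addrCA subrr addr0.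
  move=> i y py; rewrite /jump (pdD i (Ck_shift Cp) (CkN Cp) py) (pdN i Cp py).
  rewrite (pd_shift i Cp py) (pressure_gradient i (pipe_shift py)) (pressure_gradient i py).
  have P2 k : periodic (pd k (pd k (U i))).
    by apply: periodic_pd; [apply: Ck_pd; exact: Ck_velocity|exact: periodic_grad].
  by rewrite !P2// !periodic_grad// !periodic_velocity// subrr.
move: (jump 0) jumpE => k pk.
have Cm : Ck 1 (momentum_flux 2) by rewrite /momentum_flux; solve_Ck.
have := @is_derive_0_is_cst _ _ L 0 is_derive_momentum.
rewrite -[L]add0r sint_shift.
rewrite (@eq_sint _ _ (fun x => (momentum_flux 2 x + p x) + k)); last first.
  move=> x px; rewrite pk// /momentum_flux !periodic_grad// !periodic_velocity//.
  by rewrite addrA.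
rewrite [X in X = _]sintD; last 2 first.
- by apply: cextD; [exact: Ck_cext Cm|exact: Ck_cext Cp].
- exact: (Ck_cext (Ck_cst 0 k)).
move=> /eqP; rewrite -subr_eq0 addrAC subrr add0r sint_cst mulf_eq0.
rewrite (gt_eqF (@disk_area_gt0 R)) orbF => /eqP k0.
by move=> x px; rewrite pk// k0 addr0.
Qed.

(** The energy flux through a section is nonincreasing and periodic, hence
    constant. *)
Lemma periodic_dissipation_eq0 x : pipe x -> dissipation x = 0.
Proof.
apply: section_dissipation_eq0 => w.
have pE : periodic energy_flux2.
  move=> y py; rewrite /energy_flux2 /head /viscous_power.
  by rewrite periodic_pressure// !periodic_grad// !periodic_velocity.
have mono a b : a <= b -> sint energy_flux2 b <= sint energy_flux2 a.
  move=> ab; have := @derive_lower_bound _ (fun z => - sint energy_flux2 z)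
    (fun z => - - sint dissipation z) a b 0 ab.
  rewrite mul0r => h; rewrite -lerN2 -subr_ge0; apply: h => z.
    exact: is_derive_opp (is_derive_energy z).
  by move=> _; rewrite opprK; apply: sint_ge0 => y _; exact: dissipation_ge0.
(* the period centred at w *)
pose a := w - L / 2.
have L2 : 0 < L / 2 by rewrite divr_gt0.
have aL z : `|w - z| <= L / 2 -> a <= z <= a + L.
  by rewrite ler_norml /a => /andP[h1 h2]; apply/andP; split; lra.
have EL : sint energy_flux2 (a + L) = sint energy_flux2 a.
  by rewrite sint_shift; exact: eq_sint.
have cst_near : \forall z \near w, sint energy_flux2 a = sint energy_flux2 z.
  near=> z.
  have : `|w - z| <= L / 2 by near: z; exact: cvgr_dist_le.
  move=> /aL /andP[az za].
  have h1 := mono _ _ az; have h2 := mono _ _ za; rewrite EL in h2.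
  exact: (le_anti (introT andP (conj h2 h1))).
have [_ +] := is_derive_energy w.
rewrite -(near_eq_derive _ cst_near).
have [_ ->] := is_derive_const (sint energy_flux2 a) w (1 : R).
by move=> /esym/eqP; rewrite oppr_eq0 => /eqP.
Unshelve. all: by end_near. Qed.

End AxialTranslation.

(** * Axially symmetric flows without flux *)

Section AxisymmetricFlow.
Variable M : R.
Hypothesis velocity_bound : forall i x, pipe x -> `|U i x| <= M.
Hypothesis gradient_bound : forall i j x, pipe x -> `|pd i (U j) x| <= M.
Variable uz : R -> R -> R.
Hypothesis axial_symmetry : forall x, pipe x -> 0 < cyl_radius x ->
  U 2 x = uz (cyl_radius x) (x 0 2).
Variable z0 : R.
Hypothesis zero_flux : sint (U 2) z0 = 0.

(** A function of the distance to the axis is even along the tangent line to the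
    circle through a point, so its derivative in that direction vanishes. *)
Lemma axial_velocity_angular_derivative x : pipe x ->
  (- x 0 1) * pd 0 (U 2) x + x 0 0 * pd 1 (U 2) x = 0.
Proof.
move=> px; have [r0|r0] := eqVneq (rad2 x) 0.
  have e0 : x 0 0 ^+ 2 = 0 by apply/eqP; rewrite eq_le sqr_ge0 andbT -r0 lerDl sqr_ge0.
  have e1 : x 0 1 ^+ 2 = 0 by apply/eqP; rewrite eq_le sqr_ge0 andbT -r0 lerDr sqr_ge0.
  move/eqP: e0; rewrite sqrf_eq0 => /eqP ->; move/eqP: e1; rewrite sqrf_eq0 => /eqP ->.
  by rewrite oppr0 !mul0r addr0.
have {r0}r0 : 0 < rad2 x by rewrite lt_def r0 addr_ge0 ?sqr_ge0.
pose v : 'rV[R]_3 := vec3 (- x 0 1) (x 0 0) 0.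
set d := LHS.
have dv : is_derive x v (U 2) d by apply: is_derive_horizontal px; exact: Ck_velocity.
have d1 : is_derive (0 : R) 1 (fun t : R => U 2 (x + t *: v)) d.
  by apply: is_derive_line; rewrite scale0r addr0.
have d2 : is_derive (0 : R) 1 (fun t : R => U 2 (x + (- t) *: v)) (- d).
  have d3 : is_derive (- (0 : R)) 1 (fun t : R => U 2 (x + t *: v)) d by rewrite oppr0.
  have := @is_derive1_comp _ (fun t : R => U 2 (x + t *: v)) -%R 0 _ _ d3 (is_deriveNid (0 : R) (1 : R)).
  by rewrite mulrN1.
have rv (t : R) : rad2 (x + t *: v) = (1 + t ^+ 2) * rad2 x.
  by rewrite /rad2 !mxE/=; ring.
have even : \forall t \near (0 : R), U 2 (x + (- t) *: v) = U 2 (x + t *: v).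
  have [e e0 eP] := @near_parallelogram _ _ x v 0 _ (near_pipe px).
  near=> t.
  have te : `|t| <= e by near: t; apply: cvgr0_norm_le => //; exact: cvg_id.
  have p1 := eP t 0 te ltac:(by rewrite normr0 ltW).
  have p2 := eP (- t) 0 ltac:(by rewrite normrN) ltac:(by rewrite normr0 ltW).
  rewrite !scaler0 !addr0 in p1 p2.
  have t1 (s : R) : 0 < 1 + s ^+ 2 by rewrite ltr_pwDl// sqr_ge0.
  have c1 (s : R) : 0 < cyl_radius (x + s *: v).
    by rewrite sqrtr_gt0 -/(rad2 _) rv mulr_gt0.
  rewrite !axial_symmetry//; congr uz; last by rewrite !mxE/= !mulr0.
  by rewrite /cyl_radius -!/(rad2 _) !rv sqrrN.
have := near_eq_is_derive even d2 => d3.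
have [_ e1] := d1; have [_ e2] := d3.
by move: e1; rewrite e2; move: d {dv d1 d2 d3 e2} => d h; lra.
Unshelve. all: by end_near. Qed.

Let f := U 2.
Let g := radial_mean 1 f.

Let Cf n : Ck n f. Proof. exact: Ck_velocity. Qed.

Let Cg n : Ck n g. Proof. by apply: Ck_radial_mean; exact: Cf. Qed.

Lemma radial_mean_divergence x : pipe x ->
  x 0 0 * pd 0 g x + x 0 1 * pd 1 g x = f x - 2 * g x.
Proof.
move=> px; have := radial_mean_euler (Cf 1) px.
rewrite -(pd_is_derive (is_derive_radial_mean 1 0 (Cf 1) px)).
rewrite -(pd_is_derive (is_derive_radial_mean 1 1 (Cf 1) px)).
rewrite -/g => <-; move: (radial_mean 1 f x) (pd 0 _ x) (pd 1 _ x) => a b c.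
by abstract_fields; ring.
Qed.

(** Horizontal dilations preserve the angular direction, so g inherits the
    symmetry of the axial velocity. *)
Lemma radial_mean_angular_derivative x : pipe x ->
  - x 0 1 * pd 0 g x + x 0 0 * pd 1 g x = 0.
Proof.
move=> px; have x1 : rad2 x <= 1 by exact: ltW.
rewrite (pd_is_derive (is_derive_radial_mean 1 0 (Cf 1) px)).
rewrite (pd_is_derive (is_derive_radial_mean 1 1 (Cf 1) px)).
have c i : cext (pd i f) by exact: (@Ck_cext _ 0 _ (Ck_pd i (Cf 1))).
have ca a i : cext (fun y => a * pd i f y).
  by apply: cextM (c i); exact: (Ck_cext (Ck_cst 0 a)).
have scale a i : a * radial_mean 2 (pd i f) x = radial_mean 2 (fun y => a * pd i f y) x.
  rewrite /radial_mean -RintegralZl//; last exact: radial_mean_integrable.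
  by apply: eq_Rintegral => s _; rewrite mulrCA.
rewrite !scale /radial_mean -RintegralD//; last 2 first.
- exact: (radial_mean_integrable 2 (ca _ _) x1).
- exact: (radial_mean_integrable 2 (ca _ _) x1).
rewrite (@eq_Rintegral _ _ _ _ _ (fun=> 0)) ?Rintegral_cst ?mul0r// => s.
rewrite inE/= in_itv/= => s01.
have := axial_velocity_angular_derivative (pipe_dilate s01 x1).
rewrite /dilate !vec3E -/(dilate s x) -/f.
move: (pd 0 f _) (pd 1 f _) => a b h; rewrite -(mulr0 s) -h; ring.
Qed.

(** Rotating a point of the wall does not change the distance to the axis of its
    dilates; the reference point of the wall at that height is (1, 0, x_3). *)
Lemma radial_mean_wall x : rad2 x = 1 -> forall h, continuous h ->
  (forall y, pipe y -> h y = f y) ->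
  radial_mean 1 h x = radial_mean 1 h (vec3 1 0 (x 0 2)).
Proof.
move=> x1 h ch hf; apply: eq_Rintegral => s /set_mem; rewrite /= in_itv/= => s01.
have v1 : rad2 (vec3 1 0 (x 0 2) : 'rV[R]_3) = 1.
  by rewrite /rad2 !vec3E expr1n expr0n addr0.
have radE (y : 'rV[R]_3) : rad2 y = 1 -> cyl_radius (dilate s y) = Num.sqrt (s ^+ 2).
  by rewrite /rad2 => y1; rewrite /cyl_radius !vec3E !exprMn -mulrDr y1 mulr1.
have r0 : 0 < Num.sqrt (s ^+ 2) by rewrite sqrtr_gt0 exprn_gt0//; case/andP: s01.
have px : pipe (dilate s x) by apply: pipe_dilate; rewrite ?x1.
have pv : pipe (dilate s (vec3 1 0 (x 0 2))) by apply: pipe_dilate; rewrite ?v1.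
congr (_ * _); rewrite !hf// /f !axial_symmetry ?radE//.
by rewrite !vec3E.
Qed.

Lemma axial_flux_zero z : sint f z = 0.
Proof.
by rewrite -zero_flux; exact: (@is_derive_0_is_cst _ _ z z0 is_derive_mass).
Qed.

(** On the wall, [g] takes a value [c] that depends on the height only. At that
    height (g - c) x_h is tangential, and its divergence f - 2 c integrates to the
    flux minus 2 c times the area of the disk; so [c = 0]. *)
Lemma radial_mean_lateral_zero : lateral_zero g.
Proof.
have [h ch hf] := Ck_cext (Cf 0).
exists (radial_mean 1 h); first exact: continuous_radial_mean.
split => x.
  by move=> px; apply: eq_radial_mean => //; exact: ltW.
move=> x1; rewrite (radial_mean_wall x1 ch hf).
set c := radial_mean 1 h _.
have cc n : Ck n (fun x => g x + - c) by apply: CkD; [exact: Cg|exact: Ck_cst].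
have gh y : pipe y -> radial_mean 1 h y = g y.
  by move=> py; apply: eq_radial_mean => //; exact: ltW.
have : sint (fun y => pd 0 (fun x => x 0 0 * (g x + - c)) y
    + pd 1 (fun x => x 0 1 * (g x + - c)) y) (x 0 2) = 0.
  apply: (@sint_divergence_slice _ _ _ (fun y => rad2 y * (radial_mean 1 h y - c))).
  - by apply: CkM; [exact: Ck_coord|exact: cc].
  - by apply: CkM; [exact: Ck_coord|exact: cc].
  - apply: continuous_mul.
      by apply: continuous_add; apply: continuous_mul; exact: coord_continuous.
    by apply: continuous_sub; [exact: continuous_radial_mean|exact: continuous_const].
  - by move=> y py; rewrite gh// /rad2; move: (g y) => a; abstract_fields; ring.
  - by move=> y y1 yx; rewrite (radial_mean_wall y1 ch hf) yx subrr mulr0.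
have C1 := Cg 1.
rewrite (@eq_sint _ _ (fun x => f x + - (2 * c))).
  rewrite sintD; [|exact: Ck_cext (Cf 0)|exact: (Ck_cext (Ck_cst 0 _))].
  rewrite axial_flux_zero add0r sint_cst => /eqP.
  rewrite mulf_eq0 (gt_eqF (@disk_area_gt0 R)) orbF oppr_eq0 mulf_eq0 pnatr_eq0/=.
  by move=> /eqP.
move=> y py; have := radial_mean_divergence py.
compute_pd py.
move: (pd 0 g y) (pd 1 g y) (f y) (g y) c {cc} => a b k l m; abstract_fields.
by rewrite /= => e; lra.
Qed.

Lemma radial_mean_bound x : pipe x -> `|g x| <= M.
Proof.
move=> px; apply: radial_mean_le (ltW px); first exact: Ck_cext (Cf 0).
by move=> y; exact: velocity_bound.
Qed.

Lemma radial_mean_axial_derivative_bound x : pipe x -> `|pd 2 g x| <= M.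
Proof.
move=> px; rewrite (pd_is_derive (is_derive_radial_mean 1 2 (Cf 1) px)).
apply: radial_mean_le (ltW px); first exact: (@Ck_cext _ 0 _ (Ck_pd 2 (Cf 1))).
by move=> y; exact: gradient_bound.
Qed.

Lemma axial_dissipation_le x :
  pd 0 (U 2) x ^+ 2 + pd 1 (U 2) x ^+ 2 + pd 2 (U 0) x ^+ 2 + pd 2 (U 1) x ^+ 2
  <= dissipation x.
Proof.
rewrite /dissipation; have h0 := sqr_ge0 (pd 0 (U 0) x); have h1 := sqr_ge0 (pd 1 (U 1) x).
have := sqr_ge0 (pd 0 (U 1) x + pd 1 (U 0) x).
move: (_ ^+ 2) h0 => a0 h0; move: (pd 1 (U 1) x ^+ 2) h1 => a1 h1 h2.
move: (pd 0 (U 2) x ^+ 2) (pd 1 (U 2) x ^+ 2) (pd 2 (U 0) x ^+ 2) (pd 2 (U 1) x ^+ 2) => *.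
move: (_ ^+ 2) a0 a1 h0 h1 h2 => *; lra.
Qed.

(** The divergences of g^2 x_h and of g f x_h, both zero on the wall, give
    |g|^2 = (g, f) and |f|^2 = - (g, x_h . grad_h f) in L^2 of a section. The first
    identity yields |g| <= |f|, and then the second |f| <= |grad_h f|. *)
Lemma radial_mean_poincare z :
  sint (fun x => g x * g x) z <= sint (fun x => f x * f x) z <= sint dissipation z.
Proof.
have C0 := Cf 0; have C1 := Cf 1; have C2 := Cf 2; have D0 := Cg 0; have D1 := Cg 1.
have lz k : Ck 1 k -> lateral_zero (fun x => x 0 0 * (x 0 0 * (g x * k x))
    + x 0 1 * (x 0 1 * (g x * k x))).
  move=> Ck1; have c : cext (fun x => (x 0 0 * x 0 0 + x 0 1 * x 0 1) * k x).
    by apply: (@Ck_cext _ 1); solve_Ck.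
  apply: eq_lateral_zero (lateral_zeroM c radial_mean_lateral_zero) => x px.
  by move: (g x) (k x) => a b; abstract_fields; ring.
have dv k : Ck 1 k -> sint (fun x => pd 0 (fun x => x 0 0 * (g x * k x)) x
    + pd 1 (fun x => x 0 1 * (g x * k x)) x) z = 0.
  by move=> Ck1; apply: sint_divergence (lz _ Ck1); solve_Ck.
pose A := sint (fun x => g x * g x) z; pose B := sint (fun x => g x * f x) z.
pose C := sint (fun x => f x * f x) z.
pose H x := x 0 0 * pd 0 f x + x 0 1 * pd 1 f x.
pose N x := pd 0 f x * pd 0 f x + pd 1 f x * pd 1 f x.
have cA : cext (fun x => g x * g x) by apply: (@Ck_cext _ 0); solve_Ck.
have cB : cext (fun x => g x * f x) by apply: (@Ck_cext _ 0); solve_Ck.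
have cC : cext (fun x => f x * f x) by apply: (@Ck_cext _ 0); solve_Ck.
have cH : cext (fun x => g x * H x) by apply: (@Ck_cext _ 0); rewrite /H; solve_Ck.
have cN : cext N by apply: (@Ck_cext _ 0); rewrite /N; solve_Ck.
have eBA : B = A.
  move: (dv _ D1); rewrite (@eq_sint _ _ (fun x => 2 * (g x * f x) + (- 2) * (g x * g x))); last first.
    move=> x px; have := radial_mean_divergence px; compute_pd px.
    move: (pd 0 g x) (pd 1 g x) (f x) (g x) => a b k l; abstract_fields.
    by rewrite /= => e; nra.
  rewrite sintD ?sintZ//; try by apply: cextM => //; exact: (Ck_cext (Ck_cst 0 _)).
  rewrite -/A -/B; move: (A) (B) => a b h; lra.
have eC : C + sint (fun x => g x * H x) z = 0.
  move: (dv _ C1); rewrite (@eq_sint _ _ (fun x => f x * f x + g x * H x)); last first.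
    move=> x px; have := radial_mean_divergence px; compute_pd px; rewrite /H.
    move: (pd 0 g x) (pd 1 g x) (pd 0 f x) (pd 1 f x) (f x) (g x) => a b c d k l; abstract_fields.
    by rewrite /= => e; nra.
  by rewrite sintD.
have le_AC : A <= C.
  have : B <= sint (fun x => 2^-1 * (g x * g x + f x * f x)) z.
    apply: le_sint => //.
      by apply: (@Ck_cext _ 0); solve_Ck.
    move=> x px; move: (g x) (f x) => a b; rewrite -subr_ge0.
    by rewrite (_ : _ - _ = 2^-1 * (a - b) ^+ 2); [rewrite mulr_ge0 ?invr_ge0 ?sqr_ge0|field].
  rewrite sintZ ?sintD//; last by apply: cextD.
  rewrite -/A -/C eBA; move: (A) (C) {eBA eC} => a c h; lra.
have le_C : - sint (fun x => g x * H x) z <= 2^-1 * (A + sint N z).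
  rewrite -sintN// -sintD// -sintZ; last exact: cextD.
  apply: le_sint.
  - by apply: (@Ck_cext _ 0); rewrite /H; solve_Ck.
  - by apply: (@Ck_cext _ 0); rewrite /N; solve_Ck.
  - move=> x px; rewrite /N /H.
    have : 0 <= 1 - rad2 x by rewrite subr_ge0 ltW.
    rewrite /rad2; move: (g x) (pd 0 f x) (pd 1 f x) (x 0 0) (x 0 1) => a b c s t h.
    rewrite -subr_ge0 (_ : _ - _ = 2^-1 * ((a + (s * b + t * c)) ^+ 2
      + (s * c - t * b) ^+ 2 + (1 - (s ^+ 2 + t ^+ 2)) * (b ^+ 2 + c ^+ 2))); last by field.
    apply: mulr_ge0; first by rewrite invr_ge0.
    apply: addr_ge0; first by rewrite addr_ge0 ?sqr_ge0.
    by apply: mulr_ge0 => //; rewrite addr_ge0 ?sqr_ge0.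
have le_CN : C <= sint N z.
  move: le_AC le_C (eC); move: (A) (C) (sint N z) (sint (fun x => g x * H x) z) {eBA eC}.
  by move=> a c n h *; lra.
rewrite -/A -/C le_AC; apply: (le_trans le_CN).
apply: le_sint => //; first exact: Ck_cext (Ck_dissipation 0).
move=> x px; apply: le_trans (axial_dissipation_le x).
by rewrite /N -!expr2 -addrA lerDl addr_ge0// sqr_ge0.
Qed.

Definition axial_vorticity x : R := pd 0 (U 1) x - pd 1 (U 0) x.

(** The horizontal field g (p + d_3 u_3) x_h + g w (- x_2, x_1), with w the axial
    vorticity. It vanishes on the wall with [g]. Its divergence is
    u_3 (p + d_3 u_3) plus g times the scalar product of x_h with the gradient of
    p + d_3 u_3 and the rotated gradient of w, which the momentum equation
    expresses through d_3^2 u_h and the advection. *)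
Definition pressure_flux0 x : R :=
  g x * (x 0 0 * (p x + pd 2 (U 2) x) + - (x 0 1 * axial_vorticity x)).
Definition pressure_flux1 x : R :=
  g x * (x 0 1 * (p x + pd 2 (U 2) x) + x 0 0 * axial_vorticity x).

(** Absorbs the term - g x_h . d_3^2 u_h left by the elimination of the pressure,
    as an axial derivative. *)
Definition flux_potential x : R :=
  - (g x * (x 0 0 * pd 2 (U 0) x + x 0 1 * pd 2 (U 1) x)).

Definition advection j x : R :=
  U 0 x * pd 0 (U j) x + U 1 x * pd 1 (U j) x + U 2 x * pd 2 (U j) x.

(** What remains of the axial energy flux once the pressure is eliminated: every
    term has a factor that the dissipation controls in the mean. *)
Definition reduced_flux x : R :=
  f x * (2^-1 * (U 0 x * U 0 x + U 1 x * U 1 x + U 2 x * U 2 x)) - viscous_power 2 x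
  + 2 * (U 0 x * pd 0 (U 2) x + U 1 x * pd 1 (U 2) x) - f x * pd 2 (U 2) x
  + pd 2 g x * (x 0 0 * pd 2 (U 0) x + x 0 1 * pd 2 (U 1) x)
  + g x * (x 0 0 * advection 0 x + x 0 1 * advection 1 x).

(** Both sides differ by multiples of f - 2 g - x_h . grad_h g and of the angular
    derivative of [g], which vanish. *)
Lemma pressure_elimination x : pipe x ->
  energy_flux2 x = reduced_flux x + pd 2 flux_potential x
    + (pd 0 pressure_flux0 x + pd 1 pressure_flux1 x).
Proof.
move=> px; have C1 := Cf 1; have D1 := Cg 1; have D2 := Cg 2.
apply/eqP; rewrite -subr_eq0; apply/eqP.
rewrite (_ : _ - _ = (f x - 2 * g x - (x 0 0 * pd 0 g x + x 0 1 * pd 1 g x))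
    * (p x + pd 2 (U 2) x)
  - (- x 0 1 * pd 0 g x + x 0 0 * pd 1 g x) * axial_vorticity x).
  by rewrite radial_mean_divergence// radial_mean_angular_derivative// subrr !mul0r subrr.
rewrite /energy_flux2 /reduced_flux /head /flux_potential /pressure_flux0 /pressure_flux1.
rewrite /axial_vorticity /viscous_power /advection /f.
compute_pd px.
move: (pressure_gradient 0 px) (pressure_gradient 1 px).
move: (pd 0 g x) (pd 1 g x) (pd 2 g x) (g x) (p x) => g0 g1 g2 gx p0.
eliminate_derivatives px.
by rewrite /=; ring.
Qed.

Let Cvec : [/\ Ck 1 pressure_flux0, Ck 1 pressure_flux1, Ck 1 flux_potential & Ck 1 reduced_flux].
Proof.
have C := Cf 1; have D := Cg 1; have D2 := Cg 2.
by split; rewrite /pressure_flux0 /pressure_flux1 /flux_potential /reduced_flux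
  /axial_vorticity /viscous_power /advection; solve_Ck.
Qed.

Lemma is_derive_flux_potential (z : R) :
  is_derive z 1 (sint flux_potential) (sint energy_flux2 z - sint reduced_flux z).
Proof.
have [C0 C1 CP CR] := Cvec; apply: (is_derive_eq (is_derive_sint z CP)).
have cP : cext (pd 2 flux_potential) by exact: (@Ck_cext _ 0 _ (Ck_pd 2 CP)).
have cF : cext (fun x => pd 0 pressure_flux0 x + pd 1 pressure_flux1 x).
  by apply: cextD; [exact: (@Ck_cext _ 0 _ (Ck_pd 0 C0))|exact: (@Ck_cext _ 0 _ (Ck_pd 1 C1))].
have lz : lateral_zero (fun x => x 0 0 * pressure_flux0 x + x 0 1 * pressure_flux1 x).
  have c : cext (fun x => (x 0 0 * x 0 0 + x 0 1 * x 0 1) * (p x + pd 2 (U 2) x)).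
    by apply: (@Ck_cext _ 0); solve_Ck.
  apply: eq_lateral_zero (lateral_zeroM c radial_mean_lateral_zero) => x px.
  rewrite /pressure_flux0 /pressure_flux1; move: (g x) (p x) (axial_vorticity x) => a b w.
  by abstract_fields; ring.
rewrite (@eq_sint _ energy_flux2 _ z pressure_elimination).
rewrite sintD//; last by apply: cextD => //; exact: Ck_cext CR.
rewrite sintD//; last exact: Ck_cext CR.
by rewrite (sint_divergence z C0 C1 lz) addr0 addrC addKr.
Qed.

Let M_ge0 : 0 <= M.
Proof.
have p0 : pipe (0 : 'rV[R]_3) by rewrite /pipe/= !mxE expr0n addr0 ltr01.
exact: le_trans (velocity_bound 0 p0).
Qed.

Let coord_le1 x : pipe x -> `|x 0 0| <= 1 /\ `|x 0 1| <= 1.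
Proof.
move=> px; have := ltW px; rewrite -(real_normK (num_real (x 0 0))) -(real_normK (num_real (x 0 1))) => h.
by split; rewrite -(@expr_le1 _ 2)//; apply: le_trans h; rewrite ?lerDl ?lerDr sqr_ge0.
Qed.

Let norm_mul_le (a b A B : R) : `|a| <= A -> `|b| <= B -> `|a * b| <= A * B.
Proof. by move=> aA bB; rewrite normrM ler_pM. Qed.

Lemma le_norm_sint k z (B : R) : cext k -> (forall x, pipe x -> `|k x| <= B) ->
  `|sint k z| <= B * dint (fun=> 1).
Proof.
move=> ck kB; rewrite -(sint_cst B z); apply: norm_sint_le => //.
exact: (Ck_cext (Ck_cst 0 B)).
Qed.

Lemma flux_potential_bound z : `|sint flux_potential z| <= 2 * M ^+ 2 * dint (fun=> 1).
Proof.
have [_ _ CP _] := Cvec; apply: le_norm_sint (Ck_cext CP) _ => x px.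
have [x0 x1] := coord_le1 px; rewrite /flux_potential normrN.
have h i : `|pd 2 (U i) x| <= M by exact: gradient_bound.
rewrite (_ : 2 * M ^+ 2 = M * (1 * M + 1 * M)); last by ring.
apply: norm_mul_le; first exact: radial_mean_bound.
by apply: (le_trans (ler_normD _ _)); apply: lerD; exact: norm_mul_le.
Qed.

Lemma section_dissipation_bound z : 0 <= sint dissipation z <= 12 * M ^+ 2 * dint (fun=> 1).
Proof.
have cQ := Ck_cext (Ck_dissipation 0).
apply/andP; split; first by apply: sint_ge0 => x _; exact: dissipation_ge0.
apply: le_trans (ler_norm _) _; apply: le_norm_sint => // x px.
rewrite ger0_norm ?dissipation_ge0//.
have sq (a b : R) : 0 <= b -> `|a| <= b -> a ^+ 2 <= b ^+ 2.
  by move=> b0 ab; rewrite -(real_normK (num_real a)) ler_pXn2r ?nnegrE.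
have h i j := sq _ _ M_ge0 (gradient_bound i j px).
have : (pd 0 (U 1) x + pd 1 (U 0) x) ^+ 2 <= (2 * M) ^+ 2.
  apply: sq; first by rewrite mulr_ge0.
  apply: (le_trans (ler_normD _ _)); rewrite mulr_natl mulr2n.
  by apply: lerD; exact: gradient_bound.
rewrite exprMn /dissipation => h4.
rewrite (_ : 12 * M ^+ 2 = 2 * M ^+ 2 + 2 * M ^+ 2 + 2 ^+ 2 * M ^+ 2
  + M ^+ 2 + M ^+ 2 + M ^+ 2 + M ^+ 2); last by ring.
by repeat apply: lerD; rewrite // ler_wpM2l.
Qed.

(* N bounds the coefficients in reduced_flux_bound; the summand 1 makes it positive *)
Let N := 6 * M ^+ 2 + 6 * M + 1.

Let N_gt0 : 0 < N.
Proof. by rewrite ltr_wpDl// addr_ge0// mulr_ge0// sqr_ge0. Qed.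

Let coef_le (a b : R) : a <= 6 -> b <= 6 -> a * M ^+ 2 + b * M <= N.
Proof.
move=> a6 b6; rewrite -[leLHS]addr0 /N; apply: lerD => //.
by apply: lerD; apply: ler_wpM2r => //; exact: sqr_ge0.
Qed.

Let young (c v l : R) : `|c| <= N -> 0 < l -> `|c * v| <= l + N ^+ 2 / (4 * l) * (v * v).
Proof.
move=> cN l0; apply: (@le_trans _ _ (N * `|v|)); first by rewrite normrM ler_wpM2r.
have -> : v * v = `|v| ^+ 2 by rewrite -expr2 real_normK// num_real.
rewrite -subr_ge0 (_ : _ - _ = (N * `|v| / 2 - l) ^+ 2 / l); last first.
  by move: `|v| N => w n; field; exact: lt0r_neq0.
by rewrite mulr_ge0 ?sqr_ge0// invr_ge0 ltW.
Qed.

(** The reduced flux is a combination, with bounded coefficients, of u_3, g and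
    four derivatives that enter the dissipation; each product is split by the
    inequality of Young. *)
Lemma reduced_flux_bound x l : pipe x -> 0 < l ->
  `|reduced_flux x| <= 6 * l + N ^+ 2 / (4 * l) * (f x * f x + g x * g x +
    (pd 0 f x * pd 0 f x + pd 1 f x * pd 1 f x
     + pd 2 (U 0) x * pd 2 (U 0) x + pd 2 (U 1) x * pd 2 (U 1) x)).
Proof.
move=> px l0; have [X0 X1] := coord_le1 px.
have V i := velocity_bound i px; have D i j := gradient_bound i j px.
have G2 := radial_mean_axial_derivative_bound px.
have M0 := M_ge0; have MM : 0 <= M ^+ 2 by exact: sqr_ge0.
pose c1 := 2^-1 * (U 0 x * U 0 x + U 1 x * U 1 x + U 2 x * U 2 x) - 3 * pd 2 (U 2) x.
pose c2 := x 0 0 * advection 0 x + x 0 1 * advection 1 x.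
pose c3 := - U 0 x + pd 2 g x * x 0 0; pose c4 := - U 1 x + pd 2 g x * x 0 1.
have UM i j : `|U i x * pd i (U j) x| <= M * M by exact: norm_mul_le.
have UU i : `|U i x * U i x| <= M * M by exact: norm_mul_le.
have A j : `|advection j x| <= M * M + M * M + M * M.
  by apply: (le_trans (ler_normD _ _)); apply: lerD => //;
    apply: (le_trans (ler_normD _ _)); apply: lerD.
have n1 : `|c1| <= N.
  apply: (@le_trans _ _ (2^-1 * (M * M + M * M + M * M) + 3 * M)).
    apply: (le_trans (ler_normB _ _)); apply: lerD; last first.
      by apply: norm_mul_le => //; rewrite ger0_norm.
    apply: norm_mul_le; first by rewrite ger0_norm ?invr_ge0.
    by apply: (le_trans (ler_normD _ _)); apply: lerD => //;
      apply: (le_trans (ler_normD _ _)); apply: lerD.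
  rewrite (_ : _ + _ = 3 / 2 * M ^+ 2 + 3 * M); last by move: (M) => m; field.
  by apply: coef_le; rewrite ?ler_pdivrMr// -?natrM ler_nat.
have n2 : `|c2| <= N.
  apply: (@le_trans _ _ (1 * (M * M + M * M + M * M) + 1 * (M * M + M * M + M * M))).
    by apply: (le_trans (ler_normD _ _)); apply: lerD; exact: norm_mul_le.
  rewrite (_ : _ + _ = 6 * M ^+ 2 + 0 * M); last by move: (M) => m; ring.
  by apply: coef_le.
have n34 i t : `|t| <= 1 -> `|- U i x + pd 2 g x * t| <= N.
  move=> t1; apply: (@le_trans _ _ (M + M * 1)).
    by apply: (le_trans (ler_normD _ _)); apply: lerD; [rewrite normrN|exact: norm_mul_le].
  rewrite (_ : _ + _ = 0 * M ^+ 2 + 2 * M); last by move: (M) => m; ring.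
  by apply: coef_le => //; rewrite ler_nat.
have n56 i : `|U i x| <= N.
  apply: (le_trans (V i)); rewrite (_ : M = 0 * M ^+ 2 + 1 * M); last by move: (M) => m; ring.
  by apply: coef_le => //; rewrite ler1n.
have Y c v := @young c v l ^~ l0.
have := lerD (Y _ (f x) n1) (lerD (Y _ (g x) n2) (lerD (lerD (Y _ (pd 0 f x) (n56 0))
  (Y _ (pd 1 f x) (n56 1))) (lerD (Y _ (pd 2 (U 0) x) (n34 0 _ X0)) (Y _ (pd 2 (U 1) x) (n34 1 _ X1))))).
rewrite (_ : reduced_flux x = c1 * f x + (c2 * g x + (U 0 x * pd 0 f x + U 1 x * pd 1 f x
  + ((- U 0 x + pd 2 g x * x 0 0) * pd 2 (U 0) x
  + (- U 1 x + pd 2 g x * x 0 1) * pd 2 (U 1) x)))); last first.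
  rewrite /reduced_flux /viscous_power /c1 /c2 /advection /f; move: (g x) (pd 2 g x) => a b.
  by abstract_fields; field.
move=> h; apply: le_trans (le_trans _ h) _; last first.
  rewrite le_eqVlt; apply/orP; left; apply/eqP.
  move: (N ^+ 2 / (4 * l)) (f x) (g x) (pd 0 f x) (pd 1 f x) => k a b c d.
  by abstract_fields; ring.
do 4 (apply: (le_trans (ler_normD _ _)); apply: lerD => //); exact: ler_normD.
Qed.

(** Integrating the pointwise bound with l / (6 area) in place of l; the Poincare
    inequalities bound the squares of u_3 and g, so the squares contribute at most
    three times the dissipation. *)
Lemma section_reduced_flux_bound (z l : R) : 0 < l ->
  `|sint reduced_flux z| <= l + 9 / 2 * N ^+ 2 * dint (fun=> 1) / l * sint dissipation z.
Proof.
move=> l0; have [_ _ _ CR] := Cvec.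
set a := dint (fun=> 1); have a0 : 0 < a by exact: disk_area_gt0.
pose l' := l / (6 * a); have l'0 : 0 < l' by rewrite divr_gt0// mulr_gt0.
pose k := N ^+ 2 / (4 * l').
have k0 : 0 <= k by rewrite divr_ge0 ?sqr_ge0// mulr_ge0// ltW.
pose D x := pd 0 f x * pd 0 f x + pd 1 f x * pd 1 f x
  + pd 2 (U 0) x * pd 2 (U 0) x + pd 2 (U 1) x * pd 2 (U 1) x.
pose S x := f x * f x + g x * g x + D x.
have C0 := Cf 0; have C1 := Cf 1; have D0 := Cg 0.
have cff : cext (fun x => f x * f x) by apply: (@Ck_cext _ 0); solve_Ck.
have cgg : cext (fun x => g x * g x) by apply: (@Ck_cext _ 0); solve_Ck.
have cD : cext D by apply: (@Ck_cext _ 0); rewrite /D; solve_Ck.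
have cS : cext S by apply: cextD => //; exact: cextD.
have cQ := Ck_cext (Ck_dissipation 0).
have cc c : cext (fun=> c : R) by exact: (Ck_cext (Ck_cst 0 c)).
have cB : cext (fun x => 6 * l' + k * S x) by apply: cextD => //; exact: cextM.
have le_B : `|sint reduced_flux z| <= sint (fun x => 6 * l' + k * S x) z.
  apply: norm_sint_le => //; first exact: Ck_cext CR.
  by move=> x px; exact: reduced_flux_bound.
apply: (le_trans le_B); rewrite sintD//; last exact: cextM.
rewrite sint_cst sintZ// -/a.
have -> : 6 * l' * a = l by rewrite /l'; field; rewrite ?lt0r_neq0.
rewrite lerD2l.
have S3 : sint S z <= 3 * sint dissipation z.
  rewrite (@sintD _ (fun x => f x * f x + g x * g x) D z (cextD cff cgg) cD).
  rewrite (@sintD _ (fun x => f x * f x) (fun x => g x * g x) z cff cgg).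
  have /andP[h1 h2] := radial_mean_poincare z.
  have h3 : sint D z <= sint dissipation z.
    by apply: le_sint => // x px; rewrite /D -!expr2; exact: axial_dissipation_le.
  rewrite (_ : 3 * _ = sint dissipation z + sint dissipation z + sint dissipation z); last first.
    by move: (sint _ z) => q; ring.
  by repeat apply: lerD => //; exact: le_trans h1 h2.
apply: (le_trans (ler_wpM2l k0 S3)).
rewrite le_eqVlt; apply/orP; left; apply/eqP.
rewrite /k /l'; move: (sint _ z) (N) => q n; field.
by rewrite ?lt0r_neq0.
Qed.

Lemma axisymmetric_dissipation_eq0 x : pipe x -> dissipation x = 0.
Proof.
apply: section_dissipation_eq0.
apply: (@dissipation_eq0 _ _ _ _ _ (9 / 2 * N ^+ 2 * dint (fun=> 1)) _ _
  is_derive_energy is_derive_flux_potential section_dissipation_bound flux_potential_bound).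
  by rewrite !mulr_gt0 ?invr_gt0 ?exprn_gt0// disk_area_gt0.
exact: section_reduced_flux_bound.
Qed.

End AxisymmetricFlow.
End Flow.

(** * Classification of the flows *)

Unset Implicit Arguments.
Theorem theorem1p1 (R : realType) (u : 'rV[R]_3 -> 'rV[R]_3)
    (p : 'rV[R]_3 -> R) (up_sol : smooth_slip_NS_solution u p) :
  (W1infty u -> axially_symmetric u ->
   forall z0 : R, flux u z0 = 0 ->
   exists C1 : R,
     (forall x, pipe x -> u x = (C1 * cyl_radius x) *: e_theta x) /\
     (exists c : R, forall x, pipe x ->
        p x = C1 ^+ 2 * cyl_radius x ^+ 2 / 2 + c)) /\
  (z_periodic u ->
   exists C1 C2 : R,
     (forall x, pipe x ->
        u x = (C1 * cyl_radius x) *: e_theta x + C2 *: e_z R) /\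
     (exists c : R, forall x, pipe x ->
        p x = C1 ^+ 2 * cyl_radius x ^+ 2 / 2 + c)).
Proof.
have cyl2 (x : 'rV[R]_3) : cyl_radius x ^+ 2 = x 0 0 ^+ 2 + x 0 1 ^+ 2.
  by rewrite sqr_sqrtr// addr_ge0 ?sqr_ge0.
have swirl (c : R) (x : 'rV[R]_3) : (c * cyl_radius x) *: e_theta x = vec3 (- (c * x 0 1)) (c * x 0 0) 0.
  have [r0|r0] := eqVneq (cyl_radius x) 0.
    have := cyl2 x; rewrite r0 expr0n/= => /esym/eqP.
    rewrite paddr_eq0 ?sqr_ge0// !sqrf_eq0 => /andP[/eqP x0 /eqP x1].
    by rewrite mulr0 scale0r; apply: eq_vec3; rewrite !mxE/= ?x0 ?x1 ?mulr0 ?oppr0.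
  by apply: eq_vec3; rewrite !mxE/=; field.
split.
  move=> [bu bg] [ur [ut [uz usym]]] z0 flux0.
  have fluxE : flux u z0 = sint (component u 2) z0.
    by apply: eq_Rintegral => y _; rewrite /dot sum3E /e_z !vec3E !mulr0 !add0r mulr1.
  have sym x : pipe x -> 0 < cyl_radius x -> component u 2 x = uz (cyl_radius x) (x 0 2).
    by move=> px r0; rewrite /component usym// !mxE/=; ring.
  have [M [hu hg]] : exists M : R, (forall i x, pipe x -> `|component u i x| <= M) /\
      (forall i j x, pipe x -> `|pd i (component u j) x| <= M).
    have [A [_ /(_ (A + 1)) hA]] := bu; have [B [_ /(_ (B + 1)) hB]] := bg.
    have {}hA := hA (ltr_pwDr ltr01 (lexx A)); have {}hB := hB (ltr_pwDr ltr01 (lexx B)).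
    have entry m n (W : 'M[R]_(m.+1, n.+1)) i j : `|W i j| <= `|W|.
      rewrite [leRHS]mx_normrE.
      exact: (le_bigmax _ (fun ij : 'I_m.+1 * 'I_n.+1 => `|W ij.1 ij.2|) (i, j)).
    exists (Num.max (A + 1) (B + 1)); split => [i x px|i j x px]; rewrite le_max.
      by rewrite (le_trans (entry _ _ (u x) 0 i) (hA x px)).
    rewrite (le_trans _ (hB x px)) ?orbT//.
    by have := entry _ _ (vgrad u x) j i; rewrite mxE.
  have Q0 := axisymmetric_dissipation_eq0 up_sol hu hg sym (etrans (esym fluxE) flux0).
  have [C1 [C2 [uE pE]]] := rigid_motion up_sol Q0.
  exists C1; split; last by case: pE => c pE; exists c => x px; rewrite pE// cyl2.
  have C20 : C2 = 0.
    move: flux0; rewrite fluxE (@eq_sint _ _ (fun=> C2)).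
      by rewrite sint_cst => /eqP; rewrite mulf_eq0 (gt_eqF (@disk_area_gt0 R)) orbF => /eqP.
    by move=> x /uE[].
  move=> x px; rewrite swirl; have [h0 h1 h2] := uE x px.
  by apply: eq_vec3; rewrite vec3E -?C20.
move=> [L [L0 perL]].
have per i : periodic L (component u i) by move=> x px; rewrite /component perL.
have Q0 := periodic_dissipation_eq0 up_sol per L0.
have [C1 [C2 [uE pE]]] := rigid_motion up_sol Q0.
exists C1, C2; split; last by case: pE => c pE; exists c => x px; rewrite pE// cyl2.
move=> x px; rewrite swirl; have [h0 h1 h2] := uE x px.
by apply: eq_vec3; rewrite [RHS]mxE vec3E mxE vec3E ?mulr0 ?mulr1 ?addr0 ?add0r.
Qed.
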